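(* The refining relation on $[\omega]^\omega$ does not have the universality property. In fact, for any countable transitive model $M$ there is a refining real $r\in[\omega]^\omega$ over $M$ such that for any real $c\notin M$, $r$ is not refining over $M[c]$.
   Context: For $x,y\in[\omega]^\omega$, $y$ refines $x$ if $y\subseteq^*x$ or $y\subseteq^*\omega\setminus x$ (inclusion modulo finite sets). A model is a transitive set or class satisfying a fixed sufficiently large finite fragment of $\mathsf{ZF}+\mathsf{DC}$ including Powerset (e.g. restricted to $\Sigma_{2026}$-formulas). For a transitive model $N$, $r\in[\omega]^\omega$ is refining over $N$ if $r$ refines every $x\in[\omega]^\omega\cap N$. ''Real'' $c$ means $c\in\omega^\omega$; for arbitrary $c$, ''$r$ is not refining over $M[c]$'' is understood as: $r$ is not refining over any transitive model $N$ with $M\cup\{c\}\subseteq N$. The refining relation has the universality property if for every countable model $M$, every $r$ that is refining over $M$ and belongs to some forcing extension of $M$ is universally refining over $M$: for every forcing notion $\mathbb{Q}\in M$ there is a $\mathbb{Q}$-generic filter $G$ over $M$ such that $r$ is refining over $M[G]$. *)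

(* Defs.v *)
From HB Require Import structures.
From mathcomp Require Import all_boot.
From Stdlib Require Import Relation_Operators Wellfounded.
From mathcomp Require Import boolp classical_sets functions cardinality.

Set Implicit Arguments.
Unset Strict Implicit.
Unset Printing Implicit Defensive.

Local Open Scope classical_set_scope.
Local Open Scope quotient_scope.

(* Aczel's well-founded trees modulo extensional equality (bisimilarity).  With
    the classical axioms of [boolp], the quotient [V] below is a model of ZFC
    whose membership relation is well-founded and whose natural numbers are standard. *)

Inductive ens : Type := Sup (A : Type) (f : A -> ens).

Fixpoint eq_ens (x y : ens) : Prop :=
  match x, y with
  | Sup A f, Sup B g =>
      (forall a, exists b, eq_ens (f a) (g b)) /\
      (forall b, exists a, eq_ens (f a) (g b))
  end.

Lemma eq_ens_refl x : eq_ens x x.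
Proof. by elim: x => A f IH; split=> a; exists a. Qed.

Lemma eq_ens_sym x y : eq_ens x y -> eq_ens y x.
Proof.
elim: x y => A f IH [B g] /= [fg gf]; split.
- by move=> b; have [a /IH] := gf b; exists a.
- by move=> a; have [b /IH] := fg a; exists b.
Qed.

Lemma eq_ens_trans x y z : eq_ens x y -> eq_ens y z -> eq_ens x z.
Proof.
elim: x y z => A f IH [B g] [C h] /= [fg gf] [gh hg]; split.
- move=> a; have [b fgab] := fg a; have [c ghbc] := gh b.
  by exists c; apply: IH fgab ghbc.
- move=> c; have [b ghbc] := hg c; have [a fgab] := gf b.
  by exists a; apply: IH fgab ghbc.
Qed.

HB.instance Definition _ := gen_eqMixin ens.
HB.instance Definition _ := gen_choiceMixin ens.

Definition eq_ensb (x y : ens) : bool := `[<eq_ens x y>].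

Lemma eq_ensb_refl : reflexive eq_ensb.
Proof. by move=> x; apply/asboolP/eq_ens_refl. Qed.

Lemma eq_ensb_sym : symmetric eq_ensb.
Proof. by move=> x y; apply/asboolP/asboolP; apply: eq_ens_sym. Qed.

Lemma eq_ensb_trans : transitive eq_ensb.
Proof.
by move=> y x z /asboolP xy /asboolP yz; apply/asboolP/(eq_ens_trans xy yz).
Qed.

Canonical eq_ens_equiv := EquivRel eq_ensb eq_ensb_refl eq_ensb_sym eq_ensb_trans.

Definition V := {eq_quot eq_ens_equiv}.

Definition idx_ens (x : ens) : Type := let: Sup A _ := x in A.
Definition elt_ens (x : ens) : idx_ens x -> ens :=
  match x with Sup _ f => f end.

Definition idx (x : V) : Type := idx_ens (repr x).
Definition elt (x : V) (a : idx x) : V := \pi_V (elt_ens a).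
Definition vsup (A : Type) (f : A -> V) : V := \pi_V (Sup (fun a => repr (f a))).

Definition vin (x y : V) : Prop := exists a : idx y, elt a = x.

Declare Scope vset_scope.
Delimit Scope vset_scope with V.
Bind Scope vset_scope with V.
Notation "x ∈ y" := (vin x y) (at level 70, no associativity) : vset_scope.
Local Open Scope vset_scope.

Lemma pi_ensP (x y : ens) : \pi_V x = \pi_V y <-> eq_ens x y.
Proof.
split=> [xy|xy]; first by move/eqP: xy; rewrite eqmodE => /asboolP.
by apply/eqP; rewrite eqmodE; apply/asboolP.
Qed.

Lemma vin_pi x (A : Type) (f : A -> ens) :
  x ∈ \pi_V (Sup f) <-> exists a, \pi_V (f a) = x.
Proof.
have /pi_ensP : \pi_V (repr (\pi_V (Sup f))) = \pi_V (Sup f) by rewrite reprK.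
rewrite /vin /elt /idx; case: (repr _) => B g /= [gf fg]; split.
- by move=> [b <-]; have [a /pi_ensP] := gf b; exists a.
- by move=> [a <-]; have [b /pi_ensP] := fg a; exists b.
Qed.

Lemma vin_sup x (A : Type) (f : A -> V) : x ∈ vsup f <-> exists a, f a = x.
Proof. by rewrite vin_pi; split=> -[a <-]; exists a; rewrite reprK. Qed.

Lemma vext (x y : V) : (forall z, z ∈ x <-> z ∈ y) -> x = y.
Proof.
move=> xy; rewrite -[x]reprK -[y]reprK; apply/pi_ensP.
move: xy; rewrite /vin /elt /idx; case: (repr x) (repr y) => A f [B g] /= xy.
split=> [a|b].
- have [fx _] := xy (\pi_V (f a)); have [|b /pi_ensP ba] := fx; first by exists a.
  by exists b; apply: eq_ens_sym.
- have [_ gx] := xy (\pi_V (g b)); have [|a /pi_ensP ab] := gx; first by exists b.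
  by exists a.
Qed.

Lemma vin_wf : well_founded vin.
Proof.
move=> x; rewrite -[x]reprK; elim: (repr x) => A f IH; constructor=> y.
by rewrite vin_pi => -[a <-].
Qed.

Definition vempty : V := vsup (fun v : void => match v with end).

Definition vpair2 (x y : V) : V := vsup (fun b : bool => if b then x else y).

(* Kuratowski pairs. *)
Definition vpair (x y : V) : V := vpair2 (vpair2 x x) (vpair2 x y).

Definition vsucc (x : V) : V :=
  vsup (fun o : option (idx x) => if o is Some a then elt a else x).

Fixpoint vnat (n : nat) : V := if n is m.+1 then vsucc (vnat m) else vempty.

(* Subsets of omega and elements of omega^omega are taken as [set nat] and
    [nat -> nat]; the following are the elements of [V] they stand for. *)

Definition vset (x : set nat) : V := vsup (fun n : {n : nat | x n} => vnat (sval n)).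

Definition vfun (c : nat -> nat) : V :=
  vsup (fun n : nat => vpair (vnat n) (vnat (c n))).

(* Variables are natural numbers; a class, possibly proper, is a [set V]. *)

Inductive fml : Type :=
| FMem (i j : nat)
| FEq (i j : nat)
| FNot (p : fml)
| FAnd (p q : fml)
| FOr (p q : fml)
| FImp (p q : fml)
| FAll (i : nat) (p : fml)
| FEx (i : nat) (p : fml).

Definition FIff p q := FAnd (FImp p q) (FImp q p).

Definition upd (e : nat -> V) (i : nat) (x : V) : nat -> V :=
  fun j => if j == i then x else e j.

Fixpoint sat (N : set V) (e : nat -> V) (p : fml) : Prop :=
  match p with
  | FMem i j => e i ∈ e j
  | FEq i j => e i = e j
  | FNot p => ~ sat N e p
  | FAnd p q => sat N e p /\ sat N e q
  | FOr p q => sat N e p \/ sat N e q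
  | FImp p q => sat N e p -> sat N e q
  | FAll i p => forall x, N x -> sat N (upd e i x) p
  | FEx i p => exists x, N x /\ sat N (upd e i x) p
  end.

(* Truth of the universal closure of [p]. *)
Definition holds (N : set V) (p : fml) : Prop :=
  forall e, (forall i, N (e i)) -> sat N e p.

Fixpoint occurs_free (n : nat) (p : fml) : bool :=
  match p with
  | FMem i j | FEq i j => (n == i) || (n == j)
  | FNot p => occurs_free n p
  | FAnd p q | FOr p q | FImp p q => occurs_free n p || occurs_free n q
  | FAll i p | FEx i p => (n != i) && occurs_free n p
  end.

(* Abbreviations with variables as arguments.  To avoid capture, the bound
    variables are numbered above all the arguments. *)

Definition above (s : seq nat) : nat := (foldr maxn 0 s).+1.

Definition FAllIn i j p := FAll i (FImp (FMem i j) p).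
Definition FExIn i j p := FEx i (FAnd (FMem i j) p).

Definition FSub x y := let z := above [:: x; y] in FAllIn z x (FMem z y).

(* z = {x, y} *)
Definition FPair2 z x y :=
  let w := above [:: z; x; y] in FAll w (FIff (FMem w z) (FOr (FEq w x) (FEq w y))).

(* z = (x, y) *)
Definition FPair z x y :=
  let s := above [:: z; x; y] in let t := s.+1 in
  FEx s (FEx t (FAnd (FPair2 s x x) (FAnd (FPair2 t x y) (FPair2 z s t)))).

(* (x, y) \in r *)
Definition FRel r x y :=
  let z := above [:: r; x; y] in FExIn z r (FPair z x y).

Definition FEmpty x := let z := above [:: x] in FAll z (FNot (FMem z x)).

(* y = x \cup {x} *)
Definition FSucc y x :=
  let z := above [:: y; x] in FAll z (FIff (FMem z y) (FOr (FMem z x) (FEq z x))).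

Definition FInductive w :=
  let x := above [:: w] in let y := x.+1 in
  FAnd (FExIn x w (FEmpty x)) (FAllIn x w (FExIn y w (FSucc y x))).

(* w = omega, as the least inductive set *)
Definition FOmega w :=
  let i := above [:: w] in FAnd (FInductive w) (FAll i (FImp (FInductive i) (FSub w i))).

(* f is a function from x to y *)
Definition FFun f x y :=
  let u := above [:: f; x; y] in let v := u.+1 in let z := v.+1 in
  FAnd (FAllIn z f (FExIn u x (FExIn v y (FPair z u v))))
       (FAllIn u x (FEx v (FAll z (FIff (FRel f u z) (FEq z v))))).

Definition ax_ext :=
  FAll 0 (FAll 1 (FImp (FAll 2 (FIff (FMem 2 0) (FMem 2 1))) (FEq 0 1))).

Definition ax_found :=
  FAll 0 (FImp (FEx 1 (FMem 1 0)) (FExIn 1 0 (FNot (FExIn 2 0 (FMem 2 1))))).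

Definition ax_pair := FAll 0 (FAll 1 (FEx 2 (FPair2 2 0 1))).

Definition ax_union :=
  FAll 0 (FEx 1 (FAll 2 (FIff (FMem 2 1) (FExIn 3 0 (FMem 2 3))))).

Definition ax_power := FAll 0 (FEx 1 (FAll 2 (FIff (FMem 2 1) (FSub 2 0)))).

Definition ax_inf := FEx 0 (FInductive 0).

(* [p] is the property of the variable 0; its other free variables, among which
   1 is allowed, are parameters. *)
Definition ax_sep (p : fml) :=
  FAll 1 (FEx 2 (FAll 0 (FIff (FMem 0 2) (FAnd (FMem 0 1) p)))).

(* [p] relates the variable 1 to the variable 0; its other free variables, among
   which 2 is allowed, are parameters. *)
Definition ax_repl (p : fml) :=
  FAll 2 (FImp (FAllIn 0 2 (FEx 4 (FAll 1 (FIff p (FEq 1 4)))))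
               (FEx 3 (FAll 1 (FIff (FMem 1 3) (FExIn 0 2 p))))).

(* If A (variable 0) is nonempty and R (variable 1) satisfies
   forall x in A, exists y in A, (x, y) in R, then for w = omega (variable 2) there
   is f : w -> A (variable 3) with (f n, f (n + 1)) in R for all n in w. *)
Definition ax_DC :=
  FAll 0 (FAll 1
    (FImp (FAnd (FEx 4 (FMem 4 0)) (FAllIn 4 0 (FExIn 5 0 (FRel 1 4 5))))
      (FEx 2 (FEx 3
        (FAnd (FOmega 2) (FAnd (FFun 3 2 0)
          (FAllIn 4 2 (FExIn 5 2 (FAnd (FSucc 5 4)
            (FEx 6 (FEx 7 (FAnd (FRel 3 4 6)
              (FAnd (FRel 3 5 7) (FRel 1 6 7)))))))))))))).

Inductive ZFDC : set fml :=
| ZFDC_ext : ZFDC ax_ext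
| ZFDC_found : ZFDC ax_found
| ZFDC_pair : ZFDC ax_pair
| ZFDC_union : ZFDC ax_union
| ZFDC_power : ZFDC ax_power
| ZFDC_inf : ZFDC ax_inf
| ZFDC_sep p : ~~ occurs_free 2 p -> ZFDC (ax_sep p)
| ZFDC_repl p : ~~ occurs_free 3 p -> ~~ occurs_free 4 p -> ZFDC (ax_repl p)
| ZFDC_DC : ZFDC ax_DC.

Definition finite_fragment (T : set fml) : Prop :=
  [/\ finite_set T, T `<=` ZFDC & T ax_power].

Definition transitive_class (N : set V) : Prop :=
  forall x y, x ∈ y -> N y -> N x.

(* Nonemptiness is needed since [holds] is vacuous for the empty class. *)
Definition model (T : set fml) (N : set V) : Prop :=
  [/\ N !=set0, transitive_class N & forall p, T p -> holds N p].

Record forcing := Forcing { cond : V; le : V; top : V }.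

Definition vforcing (Q : forcing) : V := vpair (cond Q) (vpair (le Q) (top Q)).

Definition fle (Q : forcing) (p q : V) : Prop := vpair p q ∈ le Q.

(* A preorder with a greatest element; [fle Q p q]: p is stronger than q. *)
Definition is_forcing (Q : forcing) : Prop :=
  [/\ forall z, z ∈ le Q -> exists p q, [/\ p ∈ cond Q, q ∈ cond Q & z = vpair p q],
      forall p, p ∈ cond Q -> fle Q p p,
      forall p q s, fle Q p q -> fle Q q s -> fle Q p s,
      top Q ∈ cond Q &
      forall p, p ∈ cond Q -> fle Q p (top Q)].

Definition dense (Q : forcing) (D : V) : Prop :=
  (forall d, d ∈ D -> d ∈ cond Q) /\
  (forall p, p ∈ cond Q -> exists d, d ∈ D /\ fle Q d p).

Definition is_filter (Q : forcing) (G : V) : Prop :=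
  [/\ forall p, p ∈ G -> p ∈ cond Q,
      top Q ∈ G,
      forall p q, p ∈ G -> fle Q p q -> q ∈ G &
      forall p q, p ∈ G -> q ∈ G -> exists s, [/\ s ∈ G, fle Q s p & fle Q s q]].

Definition generic (M : set V) (Q : forcing) (G : V) : Prop :=
  is_filter Q G /\ forall D, M D -> dense Q D -> exists p, p ∈ G /\ p ∈ D.

Inductive is_name (P : V) : V -> Prop :=
| IsName tau :
    (forall z, z ∈ tau ->
       exists sigma p, [/\ is_name P sigma, p ∈ P & z = vpair sigma p]) ->
    is_name P tau.

Lemma vin_pair2 z x y : z ∈ vpair2 x y <-> z = x \/ z = y.
Proof.
rewrite vin_sup; split=> [[[] <-]|[]->]; [by left|by right|by exists true|by exists false].
Qed.

Lemma vpair2_inj x y z : vpair2 x y = vpair2 x z -> y = z.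
Proof.
move=> e; have : y ∈ vpair2 x z by rewrite -e vin_pair2; right.
have : z ∈ vpair2 x y by rewrite e vin_pair2; right.
by rewrite !vin_pair2 => -[->|->] // [->|->].
Qed.

Lemma vpair_inj x y x' y' : vpair x y = vpair x' y' -> x = x' /\ y = y'.
Proof.
move=> e; have xx' : x = x'.
  have : vpair2 x' x' ∈ vpair x y by rewrite e vin_pair2; left.
  have mem t : x' ∈ t -> t = vpair2 x x \/ t = vpair2 x y -> x' = x \/ t = vpair2 x y.
    by move=> h [et|]; [left; move: h; rewrite et vin_pair2 => -[]|right].
  rewrite vin_pair2 => /mem -[|//|e'].
    by rewrite vin_pair2; left.
  have : x ∈ vpair2 x' x' by rewrite e' vin_pair2; left.
  by rewrite vin_pair2 => -[].
by subst x'; split=> //; apply/(@vpair2_inj x)/(vpair2_inj e).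
Qed.

Definition name_lt (sigma tau : V) : Prop := exists p, vpair sigma p ∈ tau.

Lemma name_lt_wf : well_founded name_lt.
Proof.
apply: (wf_incl _ _ (clos_trans V vin)); last exact/wf_clos_trans/vin_wf.
move=> s t [p spt]; apply: (t_trans _ _ _ (vpair s p)); last exact: t_step.
apply: (t_trans _ _ _ (vpair2 s s)); apply: t_step; rewrite vin_pair2; left=> //.
Qed.

Definition vfst (z : V) : V := xget vempty [set x | exists y, z = vpair x y].

Lemma vfst_pair x y : vfst (vpair x y) = x.
Proof.
rewrite /vfst; case: xgetP => [_ -> [y' /vpair_inj[]]//|].
by move=> /(_ x) []; exists y.
Qed.

(* The indices of the elements of [tau] of the form (sigma, p) with p in [G]. *)
Definition name_idx (G tau : V) : Type :=
  {a : idx tau | exists p, p ∈ G /\ elt a = vpair (vfst (elt a)) p}.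

Lemma name_idx_lt G tau (a : name_idx G tau) : name_lt (vfst (elt (sval a))) tau.
Proof. by case: a => a [p [_ ap]] /=; exists p; rewrite -ap; exists a. Qed.

Definition vval (G : V) : V -> V :=
  Fix name_lt_wf (fun _ => V)
    (fun tau rec => vsup (fun a : name_idx G tau => rec _ (name_idx_lt a))).

Lemma vvalE G tau x :
  x ∈ vval G tau <-> exists sigma p, [/\ p ∈ G, vpair sigma p ∈ tau & x = vval G sigma].
Proof.
have -> : vval G tau =
    vsup (fun a : name_idx G tau => vval G (vfst (elt (sval a)))).
  rewrite /vval Fix_eq// => t f g fg; congr vsup.
  by apply/funext => a; rewrite fg.
rewrite vin_sup; split=> [[[a [p [pG ap]]] <-]|[s [p [pG [a ap] ->]]]].
  by exists (vfst (elt a)), p; split=> //; rewrite -ap; exists a.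
have aG : exists q, q ∈ G /\ elt a = vpair (vfst (elt a)) q.
  by exists p; rewrite ap vfst_pair.
by exists (exist _ a aG); rewrite /= ap vfst_pair.
Qed.

(* M[G] consists of the values of the names in M. *)
Definition extension (M : set V) (Q : forcing) (G : V) : set V :=
  [set vval G tau | tau in [set tau | M tau /\ is_name (cond Q) tau]].

Definition almost_subset (y x : set nat) : Prop := finite_set (y `\` x).

Definition refines (y x : set nat) : Prop :=
  almost_subset y x \/ almost_subset y (~` x).

Definition refining_over (N : set V) (r : set nat) : Prop :=
  forall x : set nat, infinite_set x -> N (vset x) -> refines r x.

Definition universally_refining_over (M : set V) (r : set nat) : Prop :=
  forall Q, is_forcing Q -> M (vforcing Q) ->
  exists G, generic M Q G /\ refining_over (extension M Q G) r.

Definition in_some_forcing_extension (M : set V) (x : V) : Prop :=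
  exists Q G, [/\ is_forcing Q, M (vforcing Q), generic M Q G & extension M Q G x].

Definition refining_universality (T : set fml) : Prop :=
  forall M : set V, model T M -> countable M ->
  forall r : set nat, infinite_set r -> refining_over M r ->
    in_some_forcing_extension M (vset r) ->
    universally_refining_over M r.

(* Main.v *)
(* Index an independent family of subsets of omega by the points of the Cantor
    space: a number [k] encodes a clopen set, and [tset d] is the set of [k] whose
    clopen set contains [d].  Each X splits [tset d] for all [d] outside an
    exceptional set [tstar X].  By independence, omega is not a finite union of sets
    with infinite exceptional sets; so, going through the reals of M, one can decide
    each of them while keeping a decreasing sequence X_0, X_1, ... of sets of M with
    finite exceptional sets.  By compactness, a finite part of X_k already splits
    [tset d] for every [d] outside a small neighbourhood of [tstar X_k].  The union
    [r] of these finite parts is refining over M and splits [tset d] for every [d]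
    outside all the [tstar X_k].  The latter are finite, coded in M, hence contained
    in M: their points are isolated, so definable by compactness.  If c is a real
    outside M, then its graph, viewed as a point of the Cantor space through
    Ackermann's coding of hereditarily finite sets, is outside all [tstar X_k], and
    the corresponding [tset d] belongs to every model containing c.

    The universality property fails for the collapse M of a countable elementary
    submodel H of V that is also closed under the countably many operations [op]: the
    real [r] built from an enumeration of the reals of M that is generic for the
    collapse of the continuum is in a forcing extension of M, but it is not refining
    over any extension of M by a Cohen real. *)
Require Import Defs.
From mathcomp Require Import all_boot zify.
From mathcomp Require Import boolp classical_sets functions cardinality.

Set Implicit Arguments.
Unset Strict Implicit.
Unset Printing Implicit Defensive.

Local Open Scope classical_set_scope.
Local Open Scope vset_scope.

(** * Ackermann's coding of hereditarily finite sets *)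

(** Membership in Ackermann's sense: the set coded by [i] is an element of the set coded by [k]. *)
Definition bit (i k : nat) : bool := odd (k %/ 2 ^ i).

Lemma bit0 i : bit i 0 = false.
Proof. by rewrite /bit div0n. Qed.

Lemma bit_lt i k : bit i k -> i < k.
Proof.
rewrite /bit => ik; apply: (leq_trans (ltn_expl i (ltnSn 1))).
by rewrite leqNgt; apply/negP => ki; rewrite divn_small in ik.
Qed.

Lemma bitS_half i k : bit i.+1 k = bit i k./2.
Proof. by rewrite /bit expnS divnMA divn2. Qed.

Lemma bit_0 k : bit 0 k = odd k.
Proof. by rewrite /bit expn0 divn1. Qed.

Lemma bit_ext k k' : (forall i, bit i k = bit i k') -> k = k'.
Proof.
suff H n : k < n -> k' < n -> (forall i, bit i k = bit i k') -> k = k'.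
  by apply: (H (k + k').+1); lia.
elim: n k k' => // -[_ k k'|n IH k k' kn kn' kk']; first by lia.
have ok : odd k = odd k' by rewrite -!bit_0 kk'.
have : k./2 = k'./2 by apply: IH => [||i]; rewrite -?bitS_half//; lia.
by lia.
Qed.

Lemma bit_pred (P : pred nat) n : exists k, forall i, bit i k = (i < n) && P i.
Proof.
elim: n P => [|n IH] P; first by exists 0 => i; rewrite bit0.
have [k kP] := IH (fun i => P i.+1); exists (P 0 + k.*2) => -[|i].
  by rewrite bit_0 oddD odd_double addbF oddb.
by rewrite bitS_half half_bit_double kP.
Qed.

Lemma bit_seq (s : seq nat) : exists k, forall i, bit i k = (i \in s).
Proof.
have [k kP] := bit_pred (mem s) (\max_(i <- s) i).+1; exists k => i.
rewrite kP andb_idl//= => si.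
by rewrite ltnS (big_rem i)//= leq_maxl.
Qed.

(* Binary increment: clear the trailing ones and set the lowest zero bit. *)
Lemma bit_succ k : exists i, [/\ i <= k, ~~ bit i k, forall j, j < i -> bit j k &
  forall v, bit v k.+1 = (v == i) || (bit v k && (i <= v))].
Proof.
elim/ltn_ind: k => k IH; have [ok|ok] := boolP (odd k); last first.
  exists 0; split=> //; first by rewrite bit_0.
  case=> [|v]; first by rewrite !bit_0 /= ok.
  by rewrite leq0n andbT /= !bitS_half; congr bit; lia.
have [|i [ik ki ji iS]] := IH k./2; first by lia.
exists i.+1; split; first by lia.
- by rewrite bitS_half.
- by case=> [|j] ij; rewrite ?bit_0// bitS_half ji.
case=> [|v]; first by rewrite !bit_0 /= ok andbF.
rewrite !bitS_half eqSS ltnS -iS; congr bit; lia.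
Qed.

(** The decoding map. The recursion is well-founded because [bit i k] implies [i < k]. *)
Definition ack : nat -> V :=
  Fix Wf_nat.lt_wf (fun _ => V) (fun k rec =>
    vsup (fun i : {i : nat | bit i k} => rec (sval i) (elimT ltP (bit_lt (svalP i))))).

Lemma ackE x k : x ∈ ack k <-> exists i, bit i k /\ x = ack i.
Proof.
have -> : ack k = vsup (fun i : {i : nat | bit i k} => ack (sval i)).
  rewrite /ack Fix_eq// => t f g fg; congr vsup.
  by apply/funext => a; rewrite fg.
rewrite vin_sup; split=> [[[i ik] <-]|[i [ik ->]]]; first by exists i.
by exists (exist _ i ik).
Qed.

Lemma ack_inj : injective ack.
Proof.
suff H n k k' : k < n -> ack k = ack k' -> k = k' by move=> k k'; exact: (H k.+1).
elim: n k k' => // n IH k k' kn kk'; apply: bit_ext => i.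
apply/idP/idP => [ik|ik'].
  have : ack i ∈ ack k by apply/ackE; exists i.
  rewrite kk' => /ackE [j [jk' /IH ->]]//.
  by have := bit_lt ik; lia.
have : ack i ∈ ack k' by apply/ackE; exists i.
rewrite -kk' => /ackE [j [jk ij]]; rewrite (_ : i = j)//; apply/esym/IH => //.
by have := bit_lt jk; lia.
Qed.

Lemma mem_ack i k : ack i ∈ ack k <-> bit i k.
Proof.
by split=> [/ackE [j [jk /ack_inj ->]]//|ik]; apply/ackE; exists i.
Qed.

Lemma ack_seq (s : seq nat) : exists k, forall x, x ∈ ack k <-> exists i, i \in s /\ x = ack i.
Proof.
have [k kP] := bit_seq s; exists k => x; rewrite ackE.
by split=> -[i [si ->]]; exists i; rewrite ?kP// -kP.
Qed.

Lemma ack_pair2 a b : exists k, ack k = vpair2 (ack a) (ack b).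
Proof.
have [k kP] := ack_seq [:: a; b]; exists k; apply: vext => x; rewrite kP vin_pair2.
split=> [[i []]|[]->]; last 2 first.
- by exists a; rewrite !inE eqxx.
- by exists b; rewrite !inE eqxx orbT.
by rewrite !inE => /orP[]/eqP-> ->; [left|right].
Qed.

Lemma ack_pair a b : exists k, ack k = vpair (ack a) (ack b).
Proof.
have [i ei] := ack_pair2 a a; have [j ej] := ack_pair2 a b.
by have [k ek] := ack_pair2 i j; exists k; rewrite ek ei ej.
Qed.

Lemma vin_empty x : ~ x ∈ vempty.
Proof. by move=> /vin_sup [[]]. Qed.

Lemma ack0 : ack 0 = vempty.
Proof.
apply: vext => x; split=> [/ackE [i []]|/vin_empty//]; by rewrite bit0.
Qed.

Lemma vin_irrefl x : ~ x ∈ x.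
Proof. by have := vin_wf x; elim=> {}x _ IH xx; apply: (IH x). Qed.

Lemma vin_succ x y : x ∈ vsucc y <-> x ∈ y \/ x = y.
Proof.
rewrite vin_sup; split=> [[[a|] <-]|[[a <-]|->]].
- by left; exists a.
- by right.
- by exists (Some a).
- by exists None.
Qed.

Lemma vin_nat x n : x ∈ vnat n <-> exists m, m < n /\ x = vnat m.
Proof.
elim: n => [|n IH] /=; first by split=> [/vin_empty//|[]// m []].
rewrite vin_succ IH; split=> [[[m [mn ->]]|->]|[m [mn ->]]].
- by exists m; split=> //; apply: ltnW.
- by exists n.
- by move: mn; rewrite ltnS leq_eqVlt => /orP[/eqP->|mn]; [right|left; exists m].
Qed.

Lemma vnat_inj : injective vnat.
Proof.
suff H m n : m < n -> vnat m <> vnat n.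
  move=> m n; have [/H//|/H nm /esym//|//] := ltngtP m n.
move=> mn e; apply: (@vin_irrefl (vnat m)); rewrite {2}e vin_nat.
by exists m.
Qed.

Lemma mem_vnat m n : vnat m ∈ vnat n <-> m < n.
Proof.
by rewrite vin_nat; split=> [[i [ni /vnat_inj->]]//|mn]; exists m.
Qed.

Lemma ack_vnat n : exists k, ack k = vnat n.
Proof.
elim: n => [|n [k kn]]; first by exists 0; rewrite ack0.
have [a aP] := ack_seq (k :: [seq i <- iota 0 k | bit i k]); exists a.
apply: vext => x; rewrite aP [vnat _]/= vin_succ -kn ackE.
split=> [[i []]|[[i [ik ->]]|->]].
- rewrite inE mem_filter => /orP[/eqP->|/andP[ik _]] ->; [by right|by left; exists i].
- by exists i; rewrite inE mem_filter ik mem_iota (bit_lt ik) orbT.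
- by exists k; rewrite inE eqxx.
Qed.

(** So the graph of a function on the naturals consists of hereditarily finite sets, and becomes a
    point of the Cantor space once each element is replaced by its code. *)
Lemma ack_vpair_vnat m n : exists k, ack k = vpair (vnat m) (vnat n).
Proof.
have [i <-] := ack_vnat m; have [j <-] := ack_vnat n; exact: ack_pair.
Qed.

(* The elements of [ack k] that are pairs (w, s) stand for the basic clopen sets
    {d | d and s agree on w}; [tr k d] says that [d] is in their union. *)
Definition tr (k : nat) (d : set nat) : Prop :=
  exists j a b, [/\ bit j k, ack j = vpair (ack a) (ack b) &
    forall u, bit u a -> (d u <-> bit u b)].

Definition agree (l : nat) (d d' : set nat) : Prop := forall u, u < l -> (d u <-> d' u).

Lemma vpair_fst x y : exists w, w ∈ vpair x y /\ x ∈ w.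
Proof. by exists (vpair2 x x); rewrite !vin_pair2; split; left. Qed.

Lemma vpair_snd x y : exists w, w ∈ vpair x y /\ y ∈ w.
Proof. by exists (vpair2 x y); rewrite !vin_pair2; split; right. Qed.

Lemma bit_pairl j a b : ack j = vpair (ack a) (ack b) -> a < j.
Proof.
move=> e; have [w [wj aw]] := vpair_fst (ack a) (ack b).
move: wj; rewrite -e => /ackE [i [ij wi]]; move: aw; rewrite wi => /mem_ack ai.
exact: (ltn_trans (bit_lt ai) (bit_lt ij)).
Qed.

Lemma agree_sym l d d' : agree l d d' -> agree l d' d.
Proof. by move=> dd' u ul; rewrite dd'. Qed.

Lemma agree_trans l d1 d2 d3 : agree l d1 d2 -> agree l d2 d3 -> agree l d1 d3.
Proof. by move=> d12 d23 u ul; rewrite d12// d23. Qed.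

Lemma agreeW l l' d d' : l <= l' -> agree l' d d' -> agree l d d'.
Proof. by move=> ll' dd' u ul; apply: dd'; apply: leq_trans ll'. Qed.

(** A pair [(ack a, ack b)] coded by an element [j] of [k] only tests positions [u] with
    [u < a < j < k]. Hence the clopen set coded by [k] depends on [d] below [k] only. *)
Lemma tr_agree k d d' : agree k d d' -> tr k d <-> tr k d'.
Proof.
suff H d1 d2 : agree k d1 d2 -> tr k d1 -> tr k d2.
  by move=> dd'; split; apply: H => //; apply: agree_sym.
move=> d12 [j [a [b [jk jab ab]]]]; exists j, a, b; split=> // u ua.
rewrite -ab// d12//; apply: ltn_trans (bit_lt jk).
exact: ltn_trans (bit_lt ua) (bit_pairl jab).
Qed.

Lemma neq_agree (d d' : set nat) : d <> d' -> exists l, ~ agree l d d'.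
Proof.
move=> dd'; apply: contrapT => H; apply: dd'; apply/predeqP => u.
by apply: contrapT => du; apply: H; exists u.+1 => /(_ u (ltnSn u)).
Qed.

Lemma separate (s : seq (set nat)) :
  exists l0, forall l, l0 <= l -> {in s &, forall t t', agree l t t' -> t = t'}.
Proof.
(* A level by which the two components of [p] disagree, if they are distinct. The maximum over all
   pairs from [s] separates the whole list. *)
pose f (p : set nat * set nat) : nat := xget 0 [set l | p.1 <> p.2 -> ~ agree l p.1 p.2].
have fP p : p.1 <> p.2 -> ~ agree (f p) p.1 p.2.
  rewrite /f => pp; case: xgetP => [l -> /(_ pp)//|H].
  by have [l lP] := neq_agree pp; case: (H l).
exists (\max_(p <- [seq (x, y) | x <- s, y <- s]) f p) => l ml t t' ts t's tt'.
apply: contrapT => ne; apply: (fP (t, t') ne) => /=; apply: agreeW tt'.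
apply: leq_trans ml; rewrite (big_rem (t, t'))/= ?leq_maxl//.
by apply/allpairsP; exists (t, t').
Qed.

(** The source of the independence of the sets [tset d]: finitely many separated points can be
    distributed at will inside and outside the clopen set of a code as large as desired. *)
Lemma tr_cylinders l (s : seq (set nat)) n : exists k, n <= k /\
  forall d, tr k d <-> exists t, t \in s /\ agree l t d.
Proof.
have [a aP] := bit_pred predT l.
have bP (t : set nat) : {b | forall u, bit u b = (u < l) && `[<t u>]}.
  by apply: cid; exact: (bit_pred (fun u => `[<t u>]) l).
pose b t := sval (bP t).
have jP (t : set nat) : {j | ack j = vpair (ack a) (ack (b t))}.
  by apply: cid; exact: ack_pair.
pose j t := sval (jP t).
(* The element [n.*2.+1] contributes no cylinder and pushes [k] above [n]. *)
have [k kP] := bit_seq (n.*2.+1 :: map j s); exists k; split.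
  by have : bit n.*2.+1 k; [rewrite kP inE eqxx|move/bit_lt; lia].
(* An odd code contains the empty set, hence encodes no pair. *)
have nopair x y : ack n.*2.+1 <> vpair x y.
  move=> e; have : ack 0 ∈ ack n.*2.+1 by rewrite mem_ack bit_0 /= odd_double.
  rewrite e ack0 vin_pair2 => -[] e'; apply: (@vin_empty x);
  by rewrite e' vin_pair2; left.
move=> d; split=> [[i [a' [b' []]]]|[t [ts td]]].
  rewrite kP inE => /orP[/eqP->/nopair//|/mapP[t ts ->]].
  rewrite /j; case: (jP t) => /= _ -> /vpair_inj[/ack_inj <- /ack_inj <-] H.
  exists t; split=> // u ul; rewrite H ?aP ?ul// /b; case: (bP t) => /= b0 ->.
  by rewrite ul /=; split=> /asboolP.
exists (j t), a, (b t); split; first by rewrite kP inE map_f ?orbT.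
  by rewrite /j; case: (jP t).
move=> u; rewrite aP andbT => ul; rewrite -td// /b; case: (bP t) => /= b0 ->.
by rewrite ul /=; split=> /asboolP.
Qed.

Lemma finite_set_bound (A : set nat) : finite_set A -> exists n, forall k, A k -> k < n.
Proof.
move=> /finite_seqP[s ->]; exists (\max_(i <- s) i).+1 => k /= sk.
by rewrite ltnS (big_rem k)//= leq_maxl.
Qed.

Lemma bounded_finite_set (A : set nat) n : (forall k, A k -> k < n) -> finite_set A.
Proof. by move=> An; apply: sub_finite_set (finite_II n) => k /An. Qed.

Lemma infinite_bound (A : set nat) : (forall m, exists2 n, m <= n & A n) -> infinite_set A.
Proof.
move=> H /finite_set_bound[n An]; have [k nk /An] := H n; by rewrite ltnNge nk.
Qed.

(** * Sets splitting most members of an independent family *)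

Definition tset (d : set nat) : set nat := [set k | tr k d].

(* The reals [d] such that [X] does not split [tset d]. *)
Definition tstar (X : set nat) : set (set nat) :=
  [set d | finite_set (X `&` tset d) \/ finite_set (X `\` tset d)].

Lemma tstarS X Y : X `<=` Y -> tstar Y `<=` tstar X.
Proof.
move=> XY d [] fd; [left|right]; apply: sub_finite_set fd => k [/XY]; by split.
Qed.

(** The ideal generated by the sets with infinite exceptional set. *)
Definition small (X : set nat) : Prop := exists s : seq (set nat),
  (forall Y, Y \in s -> infinite_set (tstar Y)) /\
  (forall n, X n -> exists Y, Y \in s /\ Y n).

Definition positive X := ~ small X.

(** Since each exceptional set is infinite, pairwise distinct points can be chosen greedily, one for
    each [Y]. Up to a finite set, [Y] avoids one side of [tset t] for its point [t]; the boolean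
    records the avoided side, and [n] bounds the finitely many exceptions. *)
Lemma escape (s : seq (set nat)) : (forall Y, Y \in s -> infinite_set (tstar Y)) ->
  exists (L : seq (set nat * bool)) n, uniq (map fst L) /\
    forall Y, Y \in s -> exists2 p, p \in L &
      forall k, n <= k -> (tr k p.1 <-> p.2) -> ~ Y k.
Proof.
elim: s => [|Y s IH] sP; first by exists [::], 0.
have [|L [n [uL Ln]]] := IH; first by move=> Z sZ; apply: sP; rewrite inE sZ orbT.
have [t [Yt tL]] : exists t, tstar Y t /\ t \notin map fst L.
  apply: contrapT => H; apply: (sP Y); first by rewrite inE eqxx.
  apply: (@sub_finite_set _ _ [set` map fst L]); last exact: finite_seq.
  by move=> t Yt /=; apply: contrapT => /negP tL; apply: H; exists t.
have [b [m mP]] : exists b m, forall k, m <= k -> (tr k t <-> is_true b) -> ~ Y k.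
  case: Yt => /finite_set_bound[m mP]; [exists true, m|exists false, m];
    move=> k mk [tb bt] Yk.
    by have := mP k (conj Yk (bt isT)); rewrite ltnNge mk.
  have /mP : (Y `\` tset t) k by split=> // /tb.
  by rewrite ltnNge mk.
exists ((t, b) :: L), (maxn m n); split=> /=; first by rewrite tL.
move=> Z; rewrite inE => /orP[/eqP->|/Ln[p pL pP]].
  by exists (t, b); rewrite ?inE ?eqxx// => k; rewrite geq_max => /andP[mk _]; apply: mP.
exists p; rewrite ?inE ?pL ?orbT// => k; rewrite geq_max => /andP[_]; exact: pP.
Qed.

(** Given a finite cover by sets with infinite exceptional sets, independence yields a code [k >= n]
    lying, for every point of [L], on the side avoided by the corresponding set. Such a [k] is not
    covered. *)
Lemma positiveT : positive setT.
Proof.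
move=> [s [/escape [L [n [uL Ln]]] sT]].
have [l0 /(_ l0 (leqnn _)) lP] := separate (map fst L).
have [k [nk kP]] := tr_cylinders l0 [seq p.1 | p <- L & p.2] n.
have [Y [/Ln [p pL pP] Yk]] := sT k I; apply: (pP k nk) Yk; rewrite kP; split.
  move=> [t [/mapP[q]]]; rewrite mem_filter => /andP[q2 qL] -> /lP e.
  suff <- : q = p by [].
  have {}e : q.1 = p.1 by apply: e; apply: map_f.
  (* As the first components are distinct, an entry of [L] is determined by its point. *)
  have fi x : x \in L -> nth p L (index x.1 (map fst L)) = x.
    move=> xL; have h : index x L < size L by rewrite index_mem.
    rewrite -[in x.1](nth_index p xL) -(nth_map p p.1 fst h).
    by rewrite index_uniq ?nth_index// size_map.
  by rewrite -(fi q qL) e fi.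
by move=> p2; exists p.1; split=> //; apply/mapP; exists p; rewrite // mem_filter p2.
Qed.

Lemma positive_finite X : positive X -> finite_set (tstar X).
Proof.
move=> pX; apply: contrapT => iX; apply: pX; exists [:: X]; split=> [Y|n Xn].
  by rewrite inE => /eqP->.
by exists X; rewrite inE eqxx.
Qed.

Lemma positive_split X y : positive X -> ~ positive (X `&` y) -> positive (X `\` y).
Proof.
move=> pX; rewrite /positive notK => -[s [sP sX]] [s' [s'P s'X]]; apply: pX.
exists (s ++ s'); split=> [Y|n Xn]; first by rewrite mem_cat => /orP[/sP|/s'P].
have [yn|yn] := pselect (y n).
  by have [//|Y [Ys Yn]] := sX n; exists Y; rewrite mem_cat Ys.
by have [//|Y [Ys Yn]] := s'X n; exists Y; rewrite mem_cat Ys orbT.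
Qed.

(** The proof is that of weak Koenig's lemma. A cylinder is [bad] if no finite number of the [P n]
    covers it; one half of a bad cylinder is bad, so bad cylinders shrink to a point [t]. Some [P n]
    holds at [t], hence on a whole cylinder around it, which therefore is not bad. *)
Lemma cantor_compact (P : nat -> set nat -> Prop) :
  (forall n, exists l, forall d d', agree l d d' -> P n d -> P n d') ->
  (forall d, exists n, P n d) ->
  exists N, forall d, exists2 n, n < N & P n d.
Proof.
move=> Pl Pd; apply: contrapT => noN.
pose bad l t := forall N, exists2 d, agree l t d & forall n, n < N -> ~ P n d.
pose put (b : bool) l (t : set nat) : set nat := [set u | if u == l then b else `[<t u>]].
have putP b l t : agree l t (put b l t).
  move=> u ul; rewrite /put /=; rewrite (ltn_eqF ul).
  by split=> /asboolP.
have bad0 t : bad 0 t.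
  move=> N; apply: contrapT => H; apply: noN; exists N => d; apply: contrapT => Hd.
  by apply: H; exists d => // n nN Pn; apply: Hd; exists n.
have badS l t : bad l t -> exists b, bad l.+1 (put b l t).
  move=> blt; apply: contrapT => H.
  have nb b : exists N, forall d, agree l.+1 (put b l t) d -> exists2 n, n < N & P n d.
    apply: contrapT => Hb; apply: H; exists b => N; apply: contrapT => HN.
    apply: Hb; exists N => d bd; apply: contrapT => Hd; apply: HN; exists d => // n nN Pn.
    by apply: Hd; exists n.
  have [N1 N1P] := nb true; have [N2 N2P] := nb false.
  have [d td dP] := blt (maxn N1 N2).
  have ag b : (d l <-> is_true b) -> agree l.+1 (put b l t) d.
    move=> dl u; rewrite ltnS leq_eqVlt => /orP[/eqP->|ul].
      by rewrite /put /= eqxx dl.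
    by rewrite -putP// td.
  have [dl|dl] := pselect (d l).
    by have [|n nN] := N1P d; [exact: ag|apply: dP; rewrite leq_max nN].
  by have [|n nN] := N2P d; [exact: ag|apply: dP; rewrite leq_max nN orbT].
pose nxt l t := put (xget true [set b | bad l.+1 (put b l t)]) l t.
pose T := fix T l := if l is l'.+1 then nxt l' (T l') else set0.
have badT l : bad l (T l).
  elim: l => [//|l IH] /=; rewrite /nxt; case: xgetP => [b _ //|H].
  by have [b bP] := badS _ _ IH; case: (H b).
have agT l m : agree l (T l) (T (m + l)).
  elim: m => [//|m IH]; apply: agree_trans IH _.
  by apply: (@agreeW _ (m + l)); [lia|exact: putP].
pose t : set nat := [set u | T u.+1 u].
have tT l : agree l t (T l).
  move=> u ul; change (T u.+1 u <-> T l u); rewrite (agT u.+1 (l - u.+1))//.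
  by rewrite (_ : l - u.+1 + u.+1 = l)//; lia.
have [n Pn] := Pd t; have [l lP] := Pl n.
have [d Td dP] := badT l n.+1; apply: (dP n) => //.
exact: lP (agree_trans (tT l) Td) Pn.
Qed.

(** The part of [X] in the interval from [m] to [N] splits [tset d] for all [d] outside the
    neighbourhood of level [l] of [tstar X]. The set [X'] stands for the next set of the sequence;
    [l] must separate the exceptional points of both, so that approximations made at consecutive
    stages can be compared. *)
Definition covering m (X X' : set nat) N : Prop :=
  (exists n, [/\ m <= n, n < N & X n]) /\
  exists l, [/\ m <= l,
    forall t t', (tstar X `|` tstar X') t -> (tstar X `|` tstar X') t' ->
      agree l t t' -> t = t' &
    forall d, (forall t, tstar X t -> ~ agree l t d) ->
      (exists n, [/\ m <= n, n < N, X n & tr n d]) /\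
      (exists n, [/\ m <= n, n < N, X n & ~ tr n d])].

(** If the points were finitely many, some level [l] would separate them all, whereas the empty set
    and the singleton of [l] agree below [l]. *)
Lemma infinite_set_nat : infinite_set [set: set nat].
Proof.
move=> /finite_seqP[s sT]; have [l /(_ l (leqnn l)) lP] := separate s.
have ms t : t \in s by have : [set: set nat] t by []; rewrite sT.
suff e : set0 = [set l] :> set nat by have : [set l] l by []; rewrite -e.
by apply: lP; rewrite ?ms// => u ul; split=> // ul'; rewrite ul' ltnn in ul.
Qed.

Lemma positive_infinite X : positive X -> infinite_set X.
Proof.
move=> /positive_finite fX X0; apply: infinite_set_nat; apply: sub_finite_set fX.
by move=> d _; left; exact: finite_setIl.
Qed.

(** Compactness is applied once for each side [b] of [tset d]. A point that is not exceptional has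
    elements of [X] beyond [m] on either side. *)
Lemma covering_exists m X X' : positive X -> positive X' -> exists N, covering m X X' N.
Proof.
move=> pX pX'; have /finite_seqP[s sE] : finite_set (tstar X `|` tstar X').
  by rewrite finite_setU; split; apply: positive_finite.
have [l0 lP] := separate s; pose l := maxn l0 m.
have cov (b : bool) : exists N, forall d, (forall t, tstar X t -> ~ agree l t d) ->
    exists n, [/\ m <= n, n < N, X n & tr n d <-> b].
  (* The first alternative discards the points close to [tstar X], so that the sets [P n] cover the
     whole space. *)
  pose P n d := [\/ exists2 t, tstar X t & agree l t d |
    [/\ m <= n, X n & tr n d <-> b]].
  have [n|d|N NP] := @cantor_compact P.
  - exists (maxn l n) => d d' dd' [[t Xt td]|[mn Xn nd]]; [left|right].
      exists t => //; apply: agree_trans td _.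
      by apply: agreeW dd'; rewrite leq_maxl.
    split=> //; rewrite -nd; apply: iff_sym; apply: tr_agree.
    by apply: agreeW dd'; rewrite leq_maxr.
  - apply: contrapT => H.
    have bn n : X n -> (tr n d <-> b) -> n < m.
      move=> Xn nb; rewrite ltnNge; apply/negP => mn; apply: H.
      by exists n; right.
    apply: H; exists 0; left; exists d => //.
    case: b {P} bn => bn; [left|right]; apply: (@bounded_finite_set _ m) => n [Xn nd].
      by apply: bn.
    by apply: bn => //; split.
  exists N => d dX; have [n nN [[t Xt td]|[mn Xn nd]]] := NP d; last by exists n.
  by case: (dX t Xt).
have [N1 N1P] := cov true; have [N2 N2P] := cov false.
have [n0 [mn0 Xn0]] : exists n, m <= n /\ X n.
  apply: contrapT => H; apply: (positive_infinite pX).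
  apply: (@bounded_finite_set _ m) => k Xk; rewrite ltnNge; apply/negP => mk.
  by apply: H; exists k.
exists (maxn n0.+1 (maxn N1 N2)); split.
  by exists n0; split=> //; rewrite leq_max leqnn.
exists l; split; first by rewrite leq_maxr.
  by move=> t t'; rewrite sE /=; apply: lP; rewrite leq_maxl.
move=> d dX; split.
  have [n [mn nN Xn [_ nd]]] := N1P d dX; exists n; split=> //; last exact: nd.
  by rewrite !leq_max nN !orbT.
have [n [mn nN Xn [nd _]]] := N2P d dX; exists n; split=> //; last by move=> /nd.
by rewrite !leq_max nN !orbT.
Qed.

(** The bound is chosen as a function of [m], [X] and [X'] alone, so that a finite part of an
    enumeration of reals determines the blocks built from it. *)
Definition bound m X X' : nat := xget 0 [set N | covering m X X' N].

Lemma boundP m X X' : positive X -> positive X' -> covering m X X' (bound m X X').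
Proof.
move=> pX pX'; rewrite /bound; case: xgetP => [//|H].
by have [N NP] := covering_exists m pX pX'; case: (H N).
Qed.

(** * The refining set built from an enumeration of reals *)

Definition shrink (X y : set nat) : set nat :=
  if pselect (positive (X `&` y)) then X `&` y else X `\` y.

Lemma positive_shrink X y : positive X -> positive (shrink X y).
Proof.
by move=> pX; rewrite /shrink; case: pselect => // ?; exact: positive_split.
Qed.

Lemma shrink_sub X y : shrink X y `<=` X.
Proof. by rewrite /shrink; case: pselect => _ n []. Qed.

Lemma shrink_refines X y : shrink X y `<=` y \/ shrink X y `<=` ~` y.
Proof.
by rewrite /shrink; case: (pselect (positive _)) => ?; [left|right] => n [].
Qed.

Definition run (s : seq (set nat)) : set nat := foldl shrink setT s.

Lemma run_rcons s y : run (rcons s y) = shrink (run s) y.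
Proof. by rewrite /run foldl_rcons. Qed.

Lemma positive_run s : positive (run s).
Proof.
by elim/last_ind: s => [|s y IH]; [exact: positiveT|rewrite run_rcons; exact: positive_shrink].
Qed.

Definition block (k : nat) (X X' : set nat) : set nat :=
  [set n | [/\ k <= n, n < bound k X X' & X n]].

(** The set [r] of the overview: [run (mkseq g k)] is the set reached once the first [k] reals are
    decided, and stage [k] contributes a finite block of it. *)
Definition generated (g : nat -> set nat) : set nat :=
  [set n | exists k, block k (run (mkseq g k)) (run (mkseq g k.+1)) n].

Lemma run_mono g j k : j <= k -> run (mkseq g k) `<=` run (mkseq g j).
Proof.
move=> /subnK <-; elim: (k - j) => [//|m IH]; rewrite addSn mkseqS run_rcons.
by apply: subset_trans IH; exact: shrink_sub.
Qed.

Lemma run_positive_bound g k : covering k (run (mkseq g k)) (run (mkseq g k.+1))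
  (bound k (run (mkseq g k)) (run (mkseq g k.+1))).
Proof. by apply: boundP; exact: positive_run. Qed.

Lemma generated_infinite g : infinite_set (generated g).
Proof.
apply: infinite_bound => m; have [[n [mn nN Xn]] _] := run_positive_bound g m.
by exists n => //; exists m.
Qed.

(** The blocks from stage [k] on lie in [run (mkseq g k)] by monotonicity, and the finitely many
    earlier ones are bounded. *)
Lemma generated_almost g k : almost_subset (generated g) (run (mkseq g k)).
Proof.
pose N j := bound j (run (mkseq g j)) (run (mkseq g j.+1)).
apply: (@bounded_finite_set _ (\max_(j < k) N j)) => n [[j [jn nN Xn]] nX].
have [kj|jk] := leqP k j; first by case: nX; apply: run_mono Xn.
by apply: leq_trans nN _; rewrite (bigD1 (Ordinal jk))//= leq_maxl.
Qed.

Lemma generated_refines g k : refines (generated g) (g k).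
Proof.
have ga := generated_almost g k.+1.
have := @shrink_refines (run (mkseq g k)) (g k); rewrite -run_rcons -mkseqS.
by case=> H; [left|right]; apply: sub_finite_set ga => n [gn gk]; split=> // /H.
Qed.

(* If the tokens of stage [k] miss [d], then [d] is [l k]-close to a point of
   [tstar (run (mkseq g k))]; since [l k] separates the points of two consecutive
   stages, these points are eventually constant, hence equal to [d]. *)
Lemma generated_splits g d : (forall k, ~ tstar (run (mkseq g k)) d) ->
  ~ refines (generated g) (tset d).
Proof.
move=> dX; pose X k := run (mkseq g k).
have {}dX k : ~ tstar (X k) d by exact: dX.
pose hit k := (exists n, [/\ k <= n, generated g n & tr n d]) /\
  (exists n, [/\ k <= n, generated g n & ~ tr n d]).
have hitk k : exists j, k <= j /\ hit j.
  apply: contrapT => H.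
  (* If no stage from [k] on meets both sides of [tset d], each of them provides a level [q.1] and
     an exceptional point [q.2] agreeing with [d] up to that level. *)
  have /choice[p pP] i : exists q : nat * set nat, [/\ k + i <= q.1,
      forall t t', (tstar (X (k + i)) `|` tstar (X (k + i).+1)) t ->
        (tstar (X (k + i)) `|` tstar (X (k + i).+1)) t' -> agree q.1 t t' -> t = t',
      tstar (X (k + i)) q.2 & agree q.1 q.2 d].
    have [_ [l [kl sep cov]]] := run_positive_bound g (k + i).
    apply: contrapT => nw; apply: H; exists (k + i); split; first exact: leq_addr.
    have [|[n1 [? ? ? ?]] [n2 [? ? ? ?]]] := cov d.
      by move=> t Xt td; apply: nw; exists (l, t).
    by split; [exists n1|exists n2]; split=> //; exists (k + i).
  have const i : (p i).2 = (p 0).2.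
    elim: i => [//|i <-]; have [_ sep Xp pd] := pP i; have [_ sep' Xp' pd'] := pP i.+1.
    have Xi : tstar (X (k + i.+1)) `<=` tstar (X (k + i)) `|` tstar (X (k + i).+1).
      by rewrite addnS => t; right.
    have Xi' : tstar (X (k + i)) `<=` tstar (X (k + i.+1)).
      by apply: tstarS; apply: run_mono; rewrite leq_add2l.
    (* Two consecutive points both agree with [d], hence with each other, up to the smaller level;
       the stage owning that level identifies them. *)
    have [ll|/ltnW ll] := leqP (p i.+1).1 (p i).1.
      apply: sep' => //; [by left|by left; exact: Xi'|].
      exact: agree_trans pd' (agreeW ll (agree_sym pd)).
    apply: sep; [exact: Xi|by left|].
    exact: agree_trans (agreeW ll pd') (agree_sym pd).
  apply: (dX k); have [_ _ + _] := pP 0; rewrite addn0.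
  rewrite (_ : (p 0).2 = d)//; apply/predeqP => u.
  have [ku _ _] := pP u.+1; rewrite const; apply.
  by apply: leq_trans ku; rewrite addnS ltnS leq_addl.
move=> [] /finite_set_bound[n nP]; have [j [nj [[m1 [jm1 gm1 m1d]] [m2 [jm2 gm2 m2d]]]]] := hitk n.
  by have := nP m2 (conj gm2 m2d); rewrite ltnNge (leq_trans nj jm2).
have /nP : (generated g `\` ~` tset d) m1 by split=> // /(_ m1d).
by rewrite ltnNge (leq_trans nj jm1).
Qed.

(** * Absoluteness for transitive classes *)

Arguments upd : simpl never.

Lemma sat_free N p e e' : (forall i, occurs_free i p -> e i = e' i) ->
  sat N e p <-> sat N e' p.
Proof.
have upd_ext i q e1 e2 x : (forall j, (j != i) && occurs_free j q -> e1 j = e2 j) ->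
    forall j, occurs_free j q -> upd e1 i x j = upd e2 i x j.
  by move=> H j jq; rewrite /upd; case: eqP => // /eqP ji; apply: H; rewrite ji.
elim: p e e' => /= [i j|i j|p IH|p IHp q IHq|p IHp q IHq|p IHp q IHq|i p IH|i p IH] e e' ee'.
- by rewrite !ee' ?eqxx ?orbT.
- by rewrite !ee' ?eqxx ?orbT.
- by rewrite (IH e e').
- by rewrite (IHp e e') ?(IHq e e')// => i iq; apply: ee'; rewrite iq ?orbT.
- by rewrite (IHp e e') ?(IHq e e')// => i iq; apply: ee'; rewrite iq ?orbT.
- by rewrite (IHp e e') ?(IHq e e')// => i iq; apply: ee'; rewrite iq ?orbT.
- by split=> H x Nx; [rewrite -(IH (upd e i x))|rewrite (IH _ (upd e' i x))];
    by [exact: H|exact: upd_ext].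
- by split=> -[x [Nx H]]; exists x; split=> //;
    [rewrite -(IH (upd e i x))|rewrite (IH _ (upd e' i x))] => //; exact: upd_ext.
Qed.

Lemma sat_mem N e i j : sat N e (FMem i j) = (e i ∈ e j). Proof. by []. Qed.

Lemma sat_eq N e i j : sat N e (FEq i j) = (e i = e j). Proof. by []. Qed.

Lemma sat_not N e p : sat N e (FNot p) = ~ sat N e p. Proof. by []. Qed.

Lemma sat_and N e p q : sat N e (FAnd p q) = (sat N e p /\ sat N e q). Proof. by []. Qed.

Lemma sat_or N e p q : sat N e (FOr p q) = (sat N e p \/ sat N e q). Proof. by []. Qed.

Lemma sat_imp N e p q : sat N e (FImp p q) = (sat N e p -> sat N e q). Proof. by []. Qed.

Lemma sat_iff N e p q : sat N e (FIff p q) = (sat N e p <-> sat N e q). Proof. by []. Qed.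

Lemma sat_all N e i p : sat N e (FAll i p) = forall x, N x -> sat N (upd e i x) p.
Proof. by []. Qed.

Lemma sat_ex N e i p : sat N e (FEx i p) = exists x, N x /\ sat N (upd e i x) p.
Proof. by []. Qed.

Definition closed_env (N : set V) (e : nat -> V) : Prop := forall i, N (e i).

Lemma closed_upd N e i x : closed_env N e -> N x -> closed_env N (upd e i x).
Proof. by move=> Ne Nx j; rewrite /upd; case: eqP. Qed.

Lemma upd_eq e i x : upd e i x i = x.
Proof. by rewrite /upd eqxx. Qed.

Lemma upd_lt e i x j : j < i -> upd e i x j = e j.
Proof. by move=> ji; rewrite /upd (ltn_eqF ji). Qed.

Lemma above_lt s j : j \in s -> j < above s.
Proof.
rewrite /above ltnS; elim: s => //= a s IH; rewrite inE => /orP[/eqP->|/IH js].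
  by rewrite leq_maxl.
by rewrite leq_max js orbT.
Qed.

Definition vadj (a x : V) : V :=
  vsup (fun o : option (idx x) => if o is Some i then elt i else a).

Lemma vin_adj z a x : z ∈ vadj a x <-> z ∈ x \/ z = a.
Proof.
rewrite vin_sup; split=> [[[i|] <-]|[[i <-]|->]].
- by left; exists i.
- by right.
- by exists (Some i).
- by exists None.
Qed.

Definition vlist (s : seq V) : V := foldr vadj vempty s.

Lemma vin_list z s : z ∈ vlist s <-> z \in s.
Proof.
elim: s => [|a s IH] /=; first by split=> // /vin_empty.
rewrite vin_adj IH inE; split=> [[->|->]|/orP[/eqP->|]]; rewrite ?eqxx ?orbT//; by [right|left].
Qed.

Lemma vin_set v x : v ∈ vset x <-> exists n, x n /\ v = vnat n.
Proof.
rewrite vin_sup; split=> [[[n xn] <-]|[n [xn ->]]]; first by exists n.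
by exists (exist _ n xn).
Qed.

Lemma vnat_in_set n x : vnat n ∈ vset x <-> x n.
Proof.
by rewrite vin_set; split=> [[m [xm /vnat_inj->]]//|xn]; exists n.
Qed.

Lemma vset_inj : injective vset.
Proof.
by move=> x y xy; apply/predeqP => n; rewrite -!vnat_in_set xy.
Qed.

Lemma vin_fun v c : v ∈ vfun c <-> exists n, v = vpair (vnat n) (vnat (c n)).
Proof. by rewrite vin_sup; split=> -[n ?]; exists n. Qed.

(** Here and in the next lemmas, absoluteness comes from transitivity: the elements to be tested,
    and the witnesses, already belong to [N]. *)
Lemma sat_FSub N e x y : transitive_class N -> closed_env N e ->
  sat N e (FSub x y) = (forall u, u ∈ e x -> u ∈ e y).
Proof.
move=> Nt Ne; rewrite /FSub; set z := above _.
have [xz yz] : x < z /\ y < z by split; apply: above_lt; rewrite !inE eqxx ?orbT.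
apply: propext; split=> H u.
  move=> ux; have := H u (Nt _ _ ux (Ne x)); rewrite /= !upd_eq !upd_lt//; exact.
by move=> Nu; rewrite /= !upd_eq !upd_lt//; exact: H.
Qed.

Lemma sat_FPair2 N e z x y : transitive_class N -> closed_env N e ->
  sat N e (FPair2 z x y) = (e z = vpair2 (e x) (e y)).
Proof.
move=> Nt Ne; rewrite /FPair2; set w := above _.
have [zw xw yw] : [/\ z < w, x < w & y < w].
  by split; apply: above_lt; rewrite !inE eqxx ?orbT.
apply: propext; split=> [H|zE].
  apply: vext => u; rewrite vin_pair2; split=> [uz|uxy].
    have [+ _] := H u (Nt _ _ uz (Ne z)).
    by rewrite /= !upd_eq !upd_lt//; exact.
  have Nu : N u by case: uxy => ->.
  by have [_ +] := H u Nu; rewrite /= !upd_eq !upd_lt//; exact.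
move=> u Nu; rewrite /= !upd_eq !upd_lt// zE vin_pair2; split; exact.
Qed.

Lemma sat_FPair N e z x y : transitive_class N -> closed_env N e ->
  sat N e (FPair z x y) = (e z = vpair (e x) (e y)).
Proof.
move=> Nt Ne; rewrite /FPair sat_ex; set s := above _.
have [zs xs ys] : [/\ z < s, x < s & y < s].
  by split; apply: above_lt; rewrite !inE eqxx ?orbT.
have lt2 j v w : j < s -> upd (upd e s v) s.+1 w j = e j.
  by move=> js; rewrite !upd_lt// ltnW.
have lts v w : upd (upd e s v) s.+1 w s = v by rewrite upd_lt ?upd_eq.
apply: propext; split=> [[v [Nv]]|zE].
  rewrite sat_ex => -[w [Nw]].
  have Ne2 : closed_env N (upd (upd e s v) s.+1 w) by do 2 apply: closed_upd => //.
  by rewrite !sat_and => -[+ [+ +]]; rewrite !sat_FPair2// !lts !upd_eq !lt2// => -> -> ->.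
have Nz := Ne z; rewrite zE in Nz.
have Nv : N (vpair2 (e x) (e x)) by apply: (Nt _ _ _ Nz); rewrite vin_pair2; left.
have Nw : N (vpair2 (e x) (e y)) by apply: (Nt _ _ _ Nz); rewrite vin_pair2; right.
exists (vpair2 (e x) (e x)); split=> //; rewrite sat_ex; exists (vpair2 (e x) (e y)); split=> //.
have Ne2 : closed_env N (upd (upd e s (vpair2 (e x) (e x))) s.+1 (vpair2 (e x) (e y))).
  by do 2 apply: closed_upd => //.
by rewrite !sat_and; split; [|split]; rewrite !sat_FPair2// ?lts ?upd_eq ?lt2//.
Qed.

Lemma sat_FRel N e r x y : transitive_class N -> closed_env N e ->
  sat N e (FRel r x y) = (vpair (e x) (e y) ∈ e r).
Proof.
move=> Nt Ne; rewrite /FRel /FExIn sat_ex; set z := above _.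
have [rz xz yz] : [/\ r < z, x < z & y < z].
  by split; apply: above_lt; rewrite !inE eqxx ?orbT.
have Ne1 v : N v -> closed_env N (upd e z v) by exact: closed_upd.
apply: propext; split=> [[v [Nv]]|xyr].
  by rewrite sat_and sat_mem => -[+]; rewrite sat_FPair; [|exact: Nt|exact: Ne1];
    rewrite !upd_eq !upd_lt// => + <-.
have Nv : N (vpair (e x) (e y)) by exact: Nt xyr (Ne r).
exists (vpair (e x) (e y)); split=> //; rewrite sat_and sat_mem.
split; first by rewrite !upd_eq !upd_lt.
by rewrite sat_FPair ?upd_eq ?upd_lt//; exact: Ne1.
Qed.

Lemma sat_FEmpty N e x : transitive_class N -> closed_env N e ->
  sat N e (FEmpty x) = (e x = vempty).
Proof.
move=> Nt Ne; rewrite /FEmpty; set z := above _.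
have xz : x < z by apply: above_lt; rewrite inE.
apply: propext; split=> [H|xE v Nv] /=; last first.
  by rewrite upd_eq upd_lt// xE; exact: vin_empty.
apply: vext => v; split=> [vx|/vin_empty//].
by have := H v (Nt _ _ vx (Ne x)); rewrite /= upd_eq upd_lt.
Qed.

Lemma sat_FSucc N e y x : transitive_class N -> closed_env N e ->
  sat N e (FSucc y x) = (e y = vsucc (e x)).
Proof.
move=> Nt Ne; rewrite /FSucc; set z := above _.
have [yz xz] : y < z /\ x < z by split; apply: above_lt; rewrite !inE eqxx ?orbT.
apply: propext; split=> [H|yE v Nv]; last first.
  by rewrite /= !upd_eq !upd_lt// yE vin_succ.
apply: vext => v; rewrite vin_succ; split=> [vy|vx].
  have [+ _] := H v (Nt _ _ vy (Ne y)).
  by rewrite /= !upd_eq !upd_lt//; exact.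
have Nv : N v by case: vx => [vx|->]; [exact: Nt vx (Ne x)|].
by have [_ +] := H v Nv; rewrite /= !upd_eq !upd_lt//; exact.
Qed.

Lemma sat_FInductive N e w : transitive_class N -> closed_env N e ->
  sat N e (FInductive w) = (vempty ∈ e w /\ forall x, x ∈ e w -> vsucc x ∈ e w).
Proof.
move=> Nt Ne; rewrite /FInductive /FAllIn /FExIn sat_and sat_ex sat_all; set x := above _.
have wx : w < x by apply: above_lt; rewrite inE.
have Ne1 v : N v -> closed_env N (upd e x v) by exact: closed_upd.
have wx1 : w < x.+1 by exact: ltnW.
apply: propext; split=> [[[v [Nv]] + H]|[e0 H]].
  rewrite sat_and sat_mem upd_eq upd_lt// => -[vw]; rewrite sat_FEmpty; [|exact: Nt|exact: Ne1].
  rewrite upd_eq => v0; rewrite -v0; split=> // u uw.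
  have Nu : N u := Nt _ _ uw (Ne w).
  have := H u Nu; rewrite sat_imp sat_mem sat_ex upd_eq upd_lt// => /(_ uw)[y [Ny]].
  rewrite sat_and sat_mem => -[+]; rewrite sat_FSucc; [|exact: Nt|by apply: closed_upd => //; exact: Ne1].
  by rewrite /= !upd_eq upd_lt// upd_lt// upd_lt// upd_eq => + <-.
split=> [|u Nu]; last first.
  rewrite sat_imp sat_mem sat_ex upd_eq upd_lt// => uw; exists (vsucc u).
  have Ns : N (vsucc u) by apply: Nt (H _ uw) (Ne w).
  split=> //; rewrite sat_and sat_mem; split; first by rewrite !upd_eq !upd_lt//; exact: H.
  rewrite sat_FSucc; [|exact: Nt|by apply: closed_upd => //; exact: Ne1].
  by rewrite upd_eq upd_lt// upd_eq.
have N0 : N vempty := Nt _ _ e0 (Ne w).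
exists vempty; split=> //; rewrite sat_and sat_mem; split; first by rewrite upd_eq upd_lt.
by rewrite sat_FEmpty ?upd_eq//; exact: Ne1.
Qed.

Lemma separation N p e x : holds N (ax_sep p) -> ~~ occurs_free 2 p -> closed_env N e -> N x ->
  exists y, N y /\ forall z, N z -> (z ∈ y <-> z ∈ x /\ sat N (upd (upd e 1 x) 0 z) p).
Proof.
move=> H p2 Ne Nx; have [y [Ny yP]] := H e Ne x Nx; exists y; split=> // z Nz.
have [z1 z2] := yP z Nz; rewrite (@sat_free _ p (upd (upd e 1 x) 0 z)
  (upd (upd (upd e 1 x) 2 y) 0 z)).
  by split; [exact: z1|exact: z2].
by move=> i ip; rewrite /upd; case: eqP => // _; case: (i =P 2) => // i2; rewrite -i2 ip in p2.
Qed.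

Lemma sat_FAllIn N e i j p : transitive_class N -> closed_env N e -> i != j ->
  sat N e (FAllIn i j p) = forall x, x ∈ e j -> sat N (upd e i x) p.
Proof.
move=> Nt Ne ij; rewrite /FAllIn; apply: propext; rewrite sat_all.
have E x : upd e i x j = e j by rewrite /upd eq_sym (negbTE ij).
split=> H x; last by move=> Nx; rewrite sat_imp sat_mem upd_eq E; exact: H.
by move=> xj; have := H x (Nt _ _ xj (Ne j)); rewrite sat_imp sat_mem upd_eq E; exact.
Qed.

Lemma sat_FExIn N e i j p : transitive_class N -> closed_env N e -> i != j ->
  sat N e (FExIn i j p) = exists x, x ∈ e j /\ sat N (upd e i x) p.
Proof.
move=> Nt Ne ij; rewrite /FExIn; apply: propext; rewrite sat_ex.
have E x : upd e i x j = e j by rewrite /upd eq_sym (negbTE ij).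
split=> -[x [+]]; first by rewrite sat_and sat_mem upd_eq E => _; exists x.
by move=> xj H; exists x; split; [exact: Nt xj (Ne j)|rewrite sat_and sat_mem upd_eq E].
Qed.

(* Variable 30 is a set of pairs (n, y); [FAckStep] says that the pair of the
   variables 20 and 21 is obtained by one binary increment, as in [bit_succ]. *)
Definition FAckLow := FAllIn 26 24 (FExIn 27 23 (FRel 30 26 27)).

Definition FAckInc := FAll 28 (FIff (FMem 28 21)
  (FOr (FEq 28 25) (FAnd (FMem 28 23) (FNot (FExIn 26 24 (FRel 30 26 28)))))).

Definition FAckStep := FEx 22 (FEx 23 (FEx 24 (FEx 25
  (FAnd (FSucc 20 22) (FAnd (FRel 30 22 23) (FAnd (FMem 24 20) (FAnd (FRel 30 24 25)
    (FAnd (FNot (FMem 25 23)) (FAnd FAckLow FAckInc))))))))).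

Definition FAck := FAll 20 (FAll 21 (FImp (FRel 30 20 21)
  (FOr (FAnd (FEmpty 20) (FEmpty 21)) FAckStep))).

(** The meaning of [FAckStep]: [p] relates numbers to the sets they code, [x] is the set coded by
    the predecessor [m] of [n], [i] is the lowest zero bit of [m], and [u] is the set coded by
    [i]. *)
Definition ack_step (p n y m x i u : V) : Prop :=
  [/\ n = vsucc m, vpair m x ∈ p, i ∈ n & vpair i u ∈ p] /\
  [/\ ~ u ∈ x, forall j, j ∈ i -> exists v, v ∈ x /\ vpair j v ∈ p &
    forall v, v ∈ y <-> v = u \/ v ∈ x /\ ~ exists j, j ∈ i /\ vpair j v ∈ p].

Lemma sat_FAckLow N e : transitive_class N -> closed_env N e ->
  sat N e FAckLow = forall j, j ∈ e 24 -> exists v, v ∈ e 23 /\ vpair j v ∈ e 30.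
Proof.
move=> Nt Ne; rewrite /FAckLow sat_FAllIn//; apply: propext.
have Ne1 j : j ∈ e 24 -> closed_env N (upd e 26 j).
  by move=> ji; apply: closed_upd => //; exact: Nt ji (Ne 24).
have Ne2 j v : j ∈ e 24 -> v ∈ e 23 -> closed_env N (upd (upd e 26 j) 27 v).
  by move=> /Ne1 Nj vx; apply: closed_upd => //; exact: Nt vx (Ne 23).
split=> H j ji; have := H j ji; have Nj := Ne1 j ji.
  rewrite sat_FExIn// => -[v [vx]]; rewrite sat_FRel//; last exact: Ne2.
  by move=> jv; exists v.
move=> [v [vx jv]]; rewrite sat_FExIn//; exists v; split=> //.
by rewrite sat_FRel//; exact: Ne2.
Qed.

Lemma sat_FAckInc N e : transitive_class N -> closed_env N e ->
  sat N e FAckInc = forall v, v ∈ e 21 <->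
    v = e 25 \/ v ∈ e 23 /\ ~ exists j, j ∈ e 24 /\ vpair j v ∈ e 30.
Proof.
move=> Nt Ne; rewrite /FAckInc sat_all.
have E v : N v -> sat N (upd e 28 v) (FIff (FMem 28 21)
    (FOr (FEq 28 25) (FAnd (FMem 28 23) (FNot (FExIn 26 24 (FRel 30 26 28)))))) =
    (v ∈ e 21 <-> v = e 25 \/ v ∈ e 23 /\ ~ exists j, j ∈ e 24 /\ vpair j v ∈ e 30).
  move=> Nv; have Ne1 := closed_upd 28 Ne Nv.
  rewrite sat_iff sat_or sat_and sat_not !sat_mem sat_eq sat_FExIn//.
  congr (_ <-> _ \/ _ /\ ~ _); apply: eq_exists => j; apply: propext.
  split=> -[ji]; have Nj : N j := Nt _ _ ji (Ne 24).
    by rewrite sat_FRel//; exact: closed_upd.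
  by split=> //; rewrite sat_FRel//; exact: closed_upd.
apply: propext; split=> H v; last by move=> Nv; rewrite E.
have [Nv|Nv] := pselect (N v); first by have := H v Nv; rewrite E.
split=> [vy|]; first by case: Nv; exact: Nt vy (Ne 21).
by case=> [vE|[vx _]]; case: Nv; [rewrite vE|exact: Nt vx (Ne 23)].
Qed.

Lemma sat_FAckStep N e : transitive_class N -> closed_env N e ->
  sat N e FAckStep = exists m x i u, ack_step (e 30) (e 20) (e 21) m x i u.
Proof.
move=> Nt Ne; rewrite /FAckStep sat_ex.
have Nel a b p : N p -> vpair a b ∈ p -> N a /\ N b.
  move=> Np abp; have Nab := Nt _ _ abp Np.
  have [w [wab aw]] := vpair_fst a b; have [w' [w'ab bw']] := vpair_snd a b.
  by split; [exact: Nt aw (Nt _ _ wab Nab)|exact: Nt bw' (Nt _ _ w'ab Nab)].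
have Ne4 m x i u : N m -> N x -> N i -> N u ->
    closed_env N (upd (upd (upd (upd e 22 m) 23 x) 24 i) 25 u).
  by move=> *; do 4 apply: closed_upd => //.
apply: propext; split=> [[m [Nm]]|[m [x [i [u [[nm mx ni iu] [ux low inc]]]]]]].
  rewrite sat_ex => -[x [Nx]]; rewrite sat_ex => -[i [Ni]]; rewrite sat_ex => -[u [Nu]].
  rewrite !sat_and sat_not !sat_mem sat_FSucc ?sat_FAckLow ?sat_FAckInc ?sat_FRel//;
    try exact: Ne4.
  by move=> [nm [mx [ni [iu [ux [low inc]]]]]]; exists m, x, i, u.
have [Nm Nx] := Nel _ _ _ (Ne 30) mx; have [Ni Nu] := Nel _ _ _ (Ne 30) iu.
exists m; split=> //; rewrite sat_ex; exists x; split=> //; rewrite sat_ex.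
exists i; split=> //; rewrite sat_ex; exists u; split=> //.
rewrite !sat_and sat_not !sat_mem sat_FSucc ?sat_FAckLow ?sat_FAckInc ?sat_FRel//;
  exact: Ne4.
Qed.

Lemma sat_FAck N e : transitive_class N -> closed_env N e ->
  sat N e FAck = forall n y, vpair n y ∈ e 30 ->
    (n = vempty /\ y = vempty) \/ exists m x i u, ack_step (e 30) n y m x i u.
Proof.
move=> Nt Ne; rewrite /FAck sat_all.
have E n y : N n -> N y -> sat N (upd (upd e 20 n) 21 y) (FImp (FRel 30 20 21)
  (FOr (FAnd (FEmpty 20) (FEmpty 21)) FAckStep)) = (vpair n y ∈ e 30 ->
    (n = vempty /\ y = vempty) \/ exists m x i u, ack_step (e 30) n y m x i u).
  move=> Nn Ny; have Ne2 : closed_env N (upd (upd e 20 n) 21 y).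
    by do 2 apply: closed_upd => //.
  by rewrite sat_imp sat_or sat_and !sat_FEmpty// sat_FAckStep// sat_FRel.
apply: propext; split=> [H n y ny|H n Nn]; last first.
  by rewrite sat_all => y Ny; rewrite E//; exact: H.
have Nny := Nt _ _ ny (Ne 30).
have [w [wn nw]] := vpair_fst n y; have [w' [w'y yw']] := vpair_snd n y.
have Nn : N n := Nt _ _ nw (Nt _ _ wn Nny).
have Ny : N y := Nt _ _ yw' (Nt _ _ w'y Nny).
by have := H n Nn; rewrite sat_all => /(_ y Ny); rewrite E//; exact.
Qed.

(** Any set satisfying [FAck] contains only correct pairs, by induction on membership in [n]: each
    pair is justified by pairs whose numbers are elements of [n]. The set may be just a part of the
    graph of [ack]. *)
Lemma sat_FAck_sound N e n y : transitive_class N -> closed_env N e ->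
  sat N e FAck -> vpair n y ∈ e 30 -> exists k, n = vnat k /\ y = ack k.
Proof.
move=> Nt Ne; rewrite sat_FAck//; set p := e 30 => H.
elim/(well_founded_ind vin_wf): n y => n IH y ny.
case: (H n y ny) => [[-> ->]|[m [x [i [u [[nm mx ni iu] [ux low inc]]]]]]].
  by exists 0; rewrite ack0.
have mn : m ∈ n by rewrite nm vin_succ; right.
have [k [mk xk]] := IH m mn x mx; have [i' [ii' ui']] := IH i ni u iu.
have nk : n = vnat k.+1 by rewrite nm mk.
have ik1 : i' < k.+1 by move: ni; rewrite nk ii' mem_vnat.
have IHn j v : j < i' -> vpair (vnat j) v ∈ p -> v = ack j.
  move=> ji jv; have [|j' [/vnat_inj <- //]] := IH (vnat j) _ v jv.
  by rewrite nk mem_vnat; exact: ltn_trans ik1.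
have {}low j : j < i' -> bit j k /\ vpair (vnat j) (ack j) ∈ p.
  move=> ji; have [|v [vx jv]] := low (vnat j); first by rewrite ii' mem_vnat.
  by have vj := IHn j v ji jv; rewrite -mem_ack -xk -vj.
have ik : ~~ bit i' k by apply/negP => ik; apply: ux; rewrite ui' xk mem_ack.
exists k.+1; split=> //; apply: vext => v.
have [i'' [_ ik'' low'' inc'']] := bit_succ k.
(* The position supplied by the formula is the lowest zero bit: it is clear and all lower bits are
   set. *)
have ei : i'' = i'.
  by have [/low[]|/low''|//] := ltngtP i'' i'; rewrite ?(negbTE ik)// (negbTE ik'').
subst i''; rewrite ackE inc; split=> [|[w [+ ->]]].
  case=> [->|[]]; first by exists i'; rewrite inc'' eqxx ui'.
  rewrite xk => /ackE[w [wk ->]] nw; exists w; rewrite inc'' wk; split=> //.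
  apply/orP; right; rewrite leqNgt; apply/negP => wi; apply: nw.
  by exists (vnat w); rewrite ii' mem_vnat; split=> //; exact: (low w wi).2.
rewrite inc'' ui' => /orP[/eqP->|/andP[wk iw]]; first by left.
right; rewrite xk mem_ack; split=> // -[j []]; rewrite ii' vin_nat => -[j' [ji ->]].
by move=> /(IHn _ _ ji) /ack_inj wj; rewrite wj leqNgt ji in iw.
Qed.

(** Finite initial segments of the graph belong to every model of [T0] and suffice as witnesses for
    [FAck]. *)
Definition ack_graph (L : nat) : V := vlist [seq vpair (vnat i) (ack i) | i <- iota 0 L].

Lemma vin_ack_graph z L : z ∈ ack_graph L <-> exists i, i < L /\ z = vpair (vnat i) (ack i).
Proof.
rewrite vin_list; split=> [/mapP[i]|[i [iL ->]]].
  by rewrite mem_iota => iL ->; exists i.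
by apply/mapP; exists i; rewrite ?mem_iota.
Qed.

Lemma sat_FAck_graph N e L : transitive_class N -> closed_env N e ->
  e 30 = ack_graph L -> sat N e FAck.
Proof.
move=> Nt Ne eL; rewrite sat_FAck// eL => n y /vin_ack_graph[k [kL /vpair_inj[-> ->]]].
case: k kL => [|k] kL; first by left; rewrite ack0.
right; have [i [ik nik low inc]] := bit_succ k.
exists (vnat k), (ack k), (vnat i), (ack i); split; split=> //.
- by apply/vin_ack_graph; exists k; split=> //; exact: ltnW.
- by apply/mem_vnat.
- by apply/vin_ack_graph; exists i; split=> //; lia.
- by rewrite mem_ack (negbTE nik).
- move=> j; rewrite vin_nat => -[j' [ji ->]]; exists (ack j'); rewrite mem_ack low//.
  by split=> //; apply/vin_ack_graph; exists j'; split=> //; lia.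
move=> v; rewrite ackE; split=> [[w [+ ->]]|].
  rewrite inc => /orP[/eqP->|/andP[wk iw]]; [by left|right].
  rewrite mem_ack wk; split=> // -[j []]; rewrite vin_nat => -[j' [ji ->]].
  move=> /vin_ack_graph[w' [_ /vpair_inj[/vnat_inj <- /ack_inj wj]]].
  by rewrite wj leqNgt ji in iw.
case=> [->|[/ackE[w [wk ->]] nw]]; first by exists i; rewrite inc eqxx.
exists w; rewrite inc wk; split=> //; apply/orP; right; rewrite leqNgt; apply/negP => wi.
apply: nw; exists (vnat w); rewrite mem_vnat; split=> //.
by apply/vin_ack_graph; exists w; split=> //; lia.
Qed.

(* The variables [k] and [D] are to be different from the bound variables 20, ..., 35. *)
Definition FTr k D := FEx 30 (FAnd FAck (FEx 31 (FAnd (FRel 30 k 31)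
  (FExIn 32 31 (FEx 33 (FEx 34 (FAnd (FPair 32 33 34)
    (FAllIn 35 33 (FIff (FMem 35 D) (FMem 35 34)))))))))).

(** The point of the Cantor space read off from [D] through Ackermann's coding. *)
Definition trace (D : V) : set nat := [set i | ack i ∈ D].

Lemma vin_pairl N x y z : transitive_class N -> N z -> vpair x y ∈ z -> N x /\ N y.
Proof.
move=> Nt Nz xyz; have Nxy := Nt _ _ xyz Nz.
have [w [wx xw]] := vpair_fst x y; have [w' [w'y yw']] := vpair_snd x y.
by split; [exact: Nt xw (Nt _ _ wx Nxy)|exact: Nt yw' (Nt _ _ w'y Nxy)].
Qed.

(** The quantifier over partial graphs is harmless: a finite graph is a witness, and
    [sat_FAck_sound] shows that no witness can give a wrong decoding. *)
Lemma sat_FTr N e k D : transitive_class N -> (forall L, N (ack_graph L)) -> closed_env N e ->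
  k < 20 -> D < 20 ->
  sat N e (FTr k D) = exists2 n, e k = vnat n & tr n (trace (e D)).
Proof.
move=> Nt Ng Ne k20 D20; rewrite /FTr sat_ex.
have Uk f i x : 20 <= i -> upd f i x k = f k.
  by move=> i20; rewrite upd_lt//; exact: leq_trans i20.
have UD f i x : 20 <= i -> upd f i x D = f D.
  by move=> i20; rewrite upd_lt//; exact: leq_trans i20.
apply: propext; split=> [[p [Np]]|[n kn [j [a [b [jn jab ab]]]]]].
  have Ne1 := closed_upd 30 Ne Np.
  rewrite sat_and sat_ex => -[Ap [A [NA]]]; have Ne2 := closed_upd 31 Ne1 NA.
  rewrite sat_and sat_FRel// !Uk// => -[].
  rewrite -[_ ∈ _]/(vpair (e k) A ∈ p) => kA.
  rewrite sat_FExIn// => -[q []]; rewrite -[_ ∈ _]/(q ∈ A) => qA.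
  have Ne3 := closed_upd 32 Ne2 (Nt _ _ qA NA).
  rewrite sat_ex => -[w [Nw]]; rewrite sat_ex => -[s [Ns]].
  have Ne5 := closed_upd 34 (closed_upd 33 Ne3 Nw) Ns.
  rewrite sat_and sat_FPair// sat_FAllIn// => -[qws ws].
  have [n [kn An]] := sat_FAck_sound Nt Ne1 Ap kA.
  exists n => //; move: qA; rewrite An => /ackE[j [jn qj]].
  have : q = vpair w s := qws; rewrite qj => jws.
  have fin x : x ∈ ack j -> forall y, y ∈ x -> exists c, y = ack c.
    by move=> /ackE[i [_ ->]] y /ackE[c [_ ->]]; exists c.
  have [v [vj wv]] := vpair_fst w s; have [v' [v'j sv']] := vpair_snd w s.
  rewrite -jws in vj v'j; have [a wa] := fin _ vj _ wv; have [b sb] := fin _ v'j _ sv'.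
  exists j, a, b; split=> //; first by rewrite -wa -sb.
  move=> u ua; have := ws (ack u); rewrite -[upd _ _ _ 33]/w wa mem_ack sat_iff !sat_mem !UD//.
  move=> /(_ ua)[H1 H2]; rewrite -mem_ack -sb; split; [exact: H1|exact: H2].
pose p := ack_graph n.+1; have Np : N p := Ng _.
have np : vpair (vnat n) (ack n) ∈ p by apply/vin_ack_graph; exists n.
have Ne1 := closed_upd 30 Ne Np; have [_ NA] := vin_pairl Nt Np np.
have Ne2 := closed_upd 31 Ne1 NA.
exists p; split=> //; rewrite sat_and; split; first exact: (sat_FAck_graph (L := n.+1)).
rewrite sat_ex; exists (ack n); split=> //.
rewrite sat_and sat_FRel// !Uk// kn; split=> //.
have jA : ack j ∈ ack n by apply/mem_ack.
have Ne3 := closed_upd 32 Ne2 (Nt _ _ jA NA).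
rewrite sat_FExIn//; exists (ack j); split=> //.
have [Na Nb] : N (ack a) /\ N (ack b).
  have Nj := Nt _ _ jA NA; rewrite jab in Nj.
  have [v [vj wv]] := vpair_fst (ack a) (ack b).
  have [v' [v'j sv']] := vpair_snd (ack a) (ack b).
  by split; [exact: Nt wv (Nt _ _ vj Nj)|exact: Nt sv' (Nt _ _ v'j Nj)].
rewrite sat_ex; exists (ack a); split=> //; rewrite sat_ex; exists (ack b); split=> //.
have Ne5 := closed_upd 34 (closed_upd 33 Ne3 Na) Nb.
rewrite sat_and sat_FPair// sat_FAllIn//; split=> //.
move=> x; rewrite -[upd _ _ _ 33]/(ack a) => /ackE[u [ua ->]].
rewrite sat_iff !sat_mem !UD// -[X in _ <-> X]/(ack u ∈ ack b) mem_ack.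
exact: ab.
Qed.

(** * Closure properties of models *)

Definition FDiff := FNot (FMem 0 3).

(** Being a natural number is expressed as belonging to the domain of a set satisfying [FAck]. *)
Definition FNat := FEx 30 (FAnd FAck (FEx 31 (FRel 30 0 31))).

(* A point [z] belongs to the only subset of the Cantor space satisfying the
   tokens in 3 and no token in 4 iff finitely many of these constraints force [z]. *)
Definition FForced := FEx 30 (FAnd FAck (FEx 5 (FEx 6 (FAnd (FRel 30 5 6)
  (FAll 7 (FImp
    (FAllIn 8 5 (FAnd (FImp (FMem 8 3) (FTr 8 7)) (FImp (FMem 8 4) (FNot (FTr 8 7)))))
    (FMem 0 7))))))).

Definition T0 : set fml := [set ax_pair] `|` [set ax_union] `|` [set ax_power] `|`
  [set ax_inf] `|` [set ax_sep FDiff] `|` [set ax_sep FNat] `|`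
  [set ax_sep (FTr 0 3)] `|` [set ax_sep FForced].

Lemma T0_fragment : finite_fragment T0.
Proof.
split; first by rewrite /T0 !finite_setU; repeat split; exact: finite_set1.
- by move=> p; do 7 (case; last by move=> ->; constructor); move=> ->; constructor.
- by do 5 left; right.
Qed.

Lemma model_sub T N : T0 `<=` T -> model T N -> model T0 N.
Proof. by move=> TT [N0 Nt NT]; split=> // p /TT; exact: NT. Qed.

Lemma model_empty T N : model T N -> N vempty.
Proof.
move=> [[x Nx] Nt _]; elim/(well_founded_ind vin_wf): x Nx => x IH Nx.
have [[y yx]|x0] := pselect (exists y, y ∈ x); first by apply: (IH y) => //; exact: Nt Nx.
suff <- : x = vempty by [].
by apply: vext => y; split=> [yx|/vin_empty//]; case: x0; exists y.
Qed.

Lemma model_env T N : model T N -> closed_env N (fun=> vempty).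
Proof. by move=> NT i; exact: model_empty NT. Qed.

Lemma model_pair2 N x y : model T0 N -> N x -> N y -> N (vpair2 x y).
Proof.
move=> NT Nx Ny; have [_ Nt H] := NT; have N0 := model_env NT.
have : holds N ax_pair by apply: H; do 7 left.
move=> /(_ _ N0 x Nx y Ny)[z [Nz]].
rewrite -[X in X -> _]/(sat N (upd (upd (upd (fun=> vempty) 0 x) 1 y) 2 z) (FPair2 2 0 1)).
rewrite sat_FPair2//; last by do 3 apply: closed_upd => //.
by rewrite -[X in X -> _]/(z = vpair2 x y) => <-.
Qed.

Lemma model_pair N x y : model T0 N -> N x -> N y -> N (vpair x y).
Proof. by move=> NT Nx Ny; do !apply: model_pair2 => //. Qed.

Lemma model_adj N a x : model T0 N -> N a -> N x -> N (vadj a x).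
Proof.
move=> NT Na Nx; have [_ Nt H] := NT; have N0 := model_env NT.
have : holds N ax_union by apply: H; do 6 left; right.
have Np : N (vpair2 x (vpair2 a a)) by do !apply: model_pair2 => //.
move=> /(_ _ N0 _ Np)[z [Nz zP]]; suff -> : vadj a x = z by [].
apply: vext => u; rewrite vin_adj; split=> [ux|uz].
  have Nu : N u by case: ux => [ux|->//]; exact: Nt ux Nx.
  apply: (zP u Nu).2; case: ux => [ux|->].
    exists x; split=> //; split; last exact: ux.
    by rewrite -[_ ∈ _]/(x ∈ vpair2 x (vpair2 a a)) vin_pair2; left.
  exists (vpair2 a a); split; first exact: model_pair2; split.
    by rewrite -[_ ∈ _]/(vpair2 a a ∈ vpair2 x (vpair2 a a)) vin_pair2; right.
  by rewrite -[_ ∈ _]/(a ∈ vpair2 a a) vin_pair2; left.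
have [v [Nv []]] := (zP u (Nt _ _ uz Nz)).1 uz.
rewrite -[X in X -> _]/(v ∈ vpair2 x (vpair2 a a)) -[X in _ -> X -> _]/(u ∈ v).
by rewrite vin_pair2 => -[->|->]; [left|rewrite vin_pair2; right; tauto].
Qed.

Lemma model_list N s : model T0 N -> (forall x, x \in s -> N x) -> N (vlist s).
Proof.
move=> NT; elim: s => [_|a s IH sN] /=; first exact: model_empty NT.
apply: model_adj => //; first by apply: sN; rewrite inE eqxx.
by apply: IH => x xs; apply: sN; rewrite inE xs orbT.
Qed.

Lemma model_ack N k : model T0 N -> N (ack k).
Proof.
move=> NT; elim/ltn_ind: k => k IH.
rewrite (_ : ack k = vlist [seq ack i | i <- iota 0 k & bit i k]).
  by apply: model_list => // x /mapP[i]; rewrite mem_filter mem_iota => /and3P[_ _ ik] ->; exact: IH.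
apply: vext => x; rewrite ackE vin_list; split=> [[i [ik ->]]|/mapP[i]].
  by apply: map_f; rewrite mem_filter ik mem_iota (bit_lt ik).
by rewrite mem_filter => /andP[ik _] ->; exists i.
Qed.

Lemma model_nat N n : model T0 N -> N (vnat n).
Proof. by move=> NT; have [k <-] := ack_vnat n; exact: model_ack. Qed.

Lemma model_graph N L : model T0 N -> N (ack_graph L).
Proof.
move=> NT; apply: model_list => // x /mapP[i _ ->].
by apply: model_pair; [|exact: model_nat|exact: model_ack].
Qed.

Lemma model_inf N : model T0 N -> exists2 w, N w & forall n, vnat n ∈ w.
Proof.
move=> NT; have [_ Nt H] := NT; have N0 := model_env NT.
have : holds N ax_inf by apply: H; do 4 left; right.
move=> /(_ _ N0)[w [Nw]].
rewrite -[X in X -> _]/(sat N (upd (fun=> vempty) 0 w) (FInductive 0)).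
rewrite sat_FInductive//; last exact: closed_upd.
by move=> [w0 wS]; exists w => //; elim=> //= n; exact: wS.
Qed.

Lemma model_power N x : model T0 N -> N x ->
  exists2 P, N P & forall z, N z -> (forall u, u ∈ z -> u ∈ x) -> z ∈ P.
Proof.
move=> NT Nx; have [_ Nt H] := NT; have N0 := model_env NT.
have : holds N ax_power by apply: H; do 5 left; right.
move=> /(_ _ N0 x Nx)[P [NP PP]]; exists P => // z Nz zx.
apply: (PP z Nz).2.
change (sat N (upd (upd (upd (fun=> vempty) 0 x) 1 P) 2 z) (FSub 2 0)).
by rewrite sat_FSub//; do 3 apply: closed_upd => //.
Qed.

(** A pair of naturals is a set of sets of naturals, so two power sets of an inductive set give a
    bound for the separation that produces the graph of [c]. *)
Lemma model_base N : model T0 N ->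
  exists2 W, N W & forall m n, vpair (vnat m) (vnat n) ∈ W.
Proof.
move=> NT; have [w Nw wP] := model_inf NT.
have [P NP PP] := model_power NT Nw; have [W NW WP] := model_power NT NP.
have Nn n := model_nat n NT; exists W => // m n; apply: WP; first exact: model_pair.
by move=> u; rewrite vin_pair2 => -[]->; apply: PP; try exact: model_pair2;
  move=> v; rewrite vin_pair2 => -[]->; exact: wP.
Qed.

Lemma model_setD N x y : model T0 N -> N (vset x) -> N (vset y) -> N (vset (x `\` y)).
Proof.
move=> NT Nx Ny; have [_ Nt H] := NT; have N0 := model_env NT.
have : holds N (ax_sep FDiff) by apply: H; do 3 left; right.
move=> /separation /(_ isT (closed_upd 3 N0 Ny) Nx)[z [Nz zP]].
suff -> : vset (x `\` y) = z by [].
apply: vext => u; have [Nu|Nu] := pselect (N u); last first.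
  split=> [/vin_set[n [_ un]]|uz]; case: Nu; last exact: Nt uz Nz.
  by rewrite un; exact: model_nat.
rewrite zP// -[X in _ <-> _ /\ X]/(~ u ∈ vset y); split=> [/vin_set[n [[xn yn] ->]]|[]].
  by rewrite !vnat_in_set.
by move=> /vin_set[n [xn ->]]; rewrite !vnat_in_set.
Qed.

(** [model_inf] may give more than omega; separation by [FNat] cuts it down. *)
Lemma model_setT N : model T0 N -> N (vset setT).
Proof.
move=> NT; have [_ Nt H] := NT; have N0 := model_env NT.
have [w Nw wP] := model_inf NT.
have : holds N (ax_sep FNat) by apply: H; do 2 left; right.
move=> /separation /(_ isT N0 Nw)[z [Nz zP]].
suff -> : vset setT = z by [].
apply: vext => u; have [Nu|Nu] := pselect (N u); last first.
  split=> [/vin_set[n [_ un]]|uz]; case: Nu; last exact: Nt uz Nz.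
  by rewrite un; exact: model_nat.
have Ne := closed_upd 0 (closed_upd 1 N0 Nw) Nu.
rewrite zP//; split=> [/vin_set[n [_ un]]|[_]].
  split; first by rewrite un.
  rewrite /FNat sat_ex; exists (ack_graph n.+1); split; first exact: model_graph.
  have Ne1 := closed_upd 30 Ne (model_graph n.+1 NT).
  rewrite sat_and; split; first exact: (sat_FAck_graph (L := n.+1)).
  rewrite sat_ex; exists (ack n); split; first exact: model_ack.
  rewrite sat_FRel//; last by apply: closed_upd => //; exact: model_ack.
  by rewrite -[_ ∈ _]/(vpair u (ack n) ∈ ack_graph n.+1) un vin_ack_graph; exists n.
rewrite /FNat sat_ex => -[p [Np]]; have Ne1 := closed_upd 30 Ne Np.
rewrite sat_and sat_ex => -[Ap [A [NA]]]; rewrite sat_FRel//; last exact: closed_upd.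
move=> uA; have [n [un _]] := sat_FAck_sound Nt Ne1 Ap uA.
by rewrite vin_set; exists n.
Qed.

Lemma model_tset N D : model T0 N -> N D -> N (vset (tset (trace D))).
Proof.
move=> NT ND; have [_ Nt H] := NT; have N0 := closed_upd 3 (model_env NT) ND.
have [w Nw wP] := model_inf NT.
have : holds N (ax_sep (FTr 0 3)) by apply: H; left; right.
move=> /separation /(_ isT N0 Nw)[z [Nz zP]].
suff -> : vset (tset (trace D)) = z by [].
apply: vext => u; have [Nu|Nu] := pselect (N u); last first.
  split=> [/vin_set[n [_ un]]|uz]; case: Nu; last exact: Nt uz Nz.
  by rewrite un; exact: model_nat.
have Ng L := model_graph L NT.
rewrite zP// sat_FTr//; last by do 2 apply: closed_upd => //.
rewrite vin_set; split=> [[n [nD un]]|[_ [n un nD]]]; last by exists n.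
by split; [rewrite un|exists n].
Qed.

(** The constraints [xp] and [xn] lie in [N] and single out the trace of [C]. By compactness each
    element of [C] is forced by finitely many of them, so [C] is obtained in [N] by separation from
    [W], although [C] itself is not a parameter. *)
Lemma model_forced N xp xn C W : model T0 N -> N (vset xp) -> N (vset xn) -> N W ->
  (forall z, z ∈ C -> z ∈ W /\ exists i, z = ack i) ->
  (forall d, ((forall k, xp k -> tr k d) /\ (forall k, xn k -> ~ tr k d)) <-> d = trace C) ->
  N C.
Proof.
move=> NT Np Nn NW CW CP; have [_ Nt H] := NT.
have N0 := closed_upd 4 (closed_upd 3 (model_env NT) Np) Nn.
have : holds N (ax_sep FForced) by apply: H; right.
move=> /separation /(_ isT N0 NW)[y [Ny yP]]; suff -> : C = y by [].
have Ng L := model_graph L NT; have [Cp Cn] := (CP (trace C)).2 erefl.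
apply: vext => z; have [Nz|Nz] := pselect (N z); last first.
  by split=> [/CW[zW _]|zy]; case: Nz; [exact: Nt zW NW|exact: Nt zy Ny].
have Ne := closed_upd 0 (closed_upd 1 N0 NW) Nz.
set e := upd _ 0 z in Ne yP *; rewrite yP//.
have body p n A D : N p -> N n -> N A -> N D ->
    sat N (upd (upd (upd (upd e 30 p) 5 n) 6 A) 7 D) (FImp
      (FAllIn 8 5 (FAnd (FImp (FMem 8 3) (FTr 8 7)) (FImp (FMem 8 4) (FNot (FTr 8 7)))))
      (FMem 0 7)) <->
    ((forall k, vnat k ∈ n -> (xp k -> tr k (trace D)) /\ (xn k -> ~ tr k (trace D))) ->
      z ∈ D).
  move=> Npp Nnn NA ND; have Ne4 : closed_env N (upd (upd (upd (upd e 30 p) 5 n) 6 A) 7 D).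
    by do 4 apply: closed_upd => //.
  rewrite sat_imp sat_FAllIn// -[X in (_ -> X) <-> _]/(z ∈ D).
  suff -> : (forall x, x ∈ n -> sat N (upd (upd (upd (upd (upd e 30 p) 5 n) 6 A) 7 D) 8 x)
    (FAnd (FImp (FMem 8 3) (FTr 8 7)) (FImp (FMem 8 4) (FNot (FTr 8 7))))) =
    (forall k, vnat k ∈ n -> (xp k -> tr k (trace D)) /\ (xn k -> ~ tr k (trace D))) by [].
  have E x : x ∈ n -> sat N (upd (upd (upd (upd (upd e 30 p) 5 n) 6 A) 7 D) 8 x)
      (FAnd (FImp (FMem 8 3) (FTr 8 7)) (FImp (FMem 8 4) (FNot (FTr 8 7)))) =
      ((x ∈ vset xp -> exists2 k, x = vnat k & tr k (trace D)) /\
       (x ∈ vset xn -> ~ exists2 k, x = vnat k & tr k (trace D))).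
    move=> xn'; have Ne5 := closed_upd 8 Ne4 (Nt _ _ xn' Nnn).
    by rewrite sat_and !sat_imp sat_not !sat_FTr// !sat_mem.
  apply: propext; split=> [HE k kn|HE x xn'].
    have := HE _ kn; rewrite E// => -[E1 E2]; split=> [kp|kn'].
      by have [|k' /vnat_inj <-] := E1; [apply/vnat_in_set|].
    by move=> kD; apply: E2; [apply/vnat_in_set|exists k].
  rewrite E//; split=> /vin_set[k [kp xk]]; rewrite xk in xn' *.
    by exists k => //; apply: (HE k xn').1.
  by move=> [k' /vnat_inj <-]; apply: (HE k xn').2.
split=> [zC|[_]].
  have [zW [i zi]] := CW z zC; split=> //.
  (* Either [d] violates the constraint of index [n] or it contains [i]; since only the trace of [C]
     violates nothing, these sets cover the space. *)
  pose P n d := [\/ xp n /\ ~ tr n d, xn n /\ tr n d | d i].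
  have [n|d|L LP] := @cantor_compact P.
  - exists (maxn n i.+1) => d d' dd'; have nd := tr_agree (agreeW (leq_maxl _ _) dd').
    have id := agreeW (leq_maxr _ _) dd' (ltnSn i).
    by rewrite /P (propext nd) (propext id).
  - apply: contrapT => Pd; have : d = trace C.
      apply/CP; split=> k xk; apply: contrapT => kd; apply: Pd; exists k.
        by apply: Or31.
      by apply: Or32; split=> //; apply: contrapT.
    by move=> dC; apply: Pd; exists 0; apply: Or33; rewrite dC /trace /= -zi.
  rewrite /FForced sat_ex; exists (ack_graph L.+1); split=> //.
  have Ne1 := closed_upd 30 Ne (Ng L.+1).
  rewrite sat_and; split; first exact: (sat_FAck_graph (L := L.+1)).
  have [NL NaL] : N (vnat L) /\ N (ack L) by split; [exact: model_nat|exact: model_ack].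
  rewrite sat_ex; exists (vnat L); split=> //; rewrite sat_ex; exists (ack L); split=> //.
  rewrite sat_and; split.
    rewrite sat_FRel//; last by do 2 apply: closed_upd => //.
    by rewrite -[_ ∈ _]/(vpair (vnat L) (ack L) ∈ ack_graph L.+1) vin_ack_graph; exists L.
  rewrite sat_all => D ND; apply/body => // DP.
  have [k kL [[kp kD]|[kn kD]|]] := LP (trace D); last by rewrite /trace /= zi.
    by case: kD; apply: (DP k _).1; rewrite ?mem_vnat.
  by case: ((DP k _).2 kn kD); rewrite mem_vnat.
rewrite /FForced sat_ex => -[p [Npp]]; have Ne1 := closed_upd 30 Ne Npp.
rewrite sat_and => -[Ap]; rewrite sat_ex => -[n [Nnn]]; rewrite sat_ex => -[A [NA]].
rewrite sat_and => -[]; rewrite sat_FRel//; last by do 2 apply: closed_upd => //.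
move=> nA; have [L [nL _]] := sat_FAck_sound Nt Ne1 Ap nA.
(* Conversely, the truncation of [C] below [L] is finite, hence in [N], and meets the constraints
   below [L] because they look at positions below [L] only. So the forced [z] lies in it, and thus
   in [C]. *)
pose D := vlist [seq ack i | i <- iota 0 L & `[<trace C i>]].
have ND : N D by apply: model_list => // x /mapP[i _ ->]; exact: model_ack.
rewrite sat_all => /(_ D ND) /(body _ _ _ _ Npp Nnn NA ND) zD.
have /vin_list/mapP[i] : z ∈ D; last first.
  by rewrite mem_filter => /andP[/asboolP iC _] ->.
apply: zD => k; rewrite (nL : n = vnat L) mem_vnat => kL.
have kD : tr k (trace C) <-> tr k (trace D).
  apply: tr_agree => u uk; split=> [uC|].
    apply: (vin_list _ _).2; apply: map_f.
    rewrite mem_filter mem_iota; apply/andP; split; [exact/asboolP|exact: (ltn_trans uk kL)].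
  by move=> /vin_list/mapP[i]; rewrite mem_filter => /andP[/asboolP iC _] /ack_inj ->.
by rewrite -(propext kD); split=> [/Cp|/Cn].
Qed.

(** The exceptional set is finite, so its point [d] is isolated by a cylinder with code [k]. This
    cylinder, and a tail of [X] on one side of [tset d], give constraints in [N] whose only solution
    is [d]. *)
Lemma model_vfun N X c : model T0 N -> N (vset X) -> positive X -> tstar X (trace (vfun c)) ->
  N (vfun c).
Proof.
move=> NT NX pX; set C := vfun c; set d := trace C => Xd.
have [W NW WP] := model_base NT.
have CW z : z ∈ C -> z ∈ W /\ exists i, z = ack i.
  move=> /vin_fun[n ->]; split; first exact: WP.
  by have [i <-] := ack_vpair_vnat n (c n); exists i.
have /finite_seqP[s sE] := positive_finite pX.
have [l /(_ l (leqnn l)) sep] := separate s.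
have [k [_ kP]] := tr_cylinders l [:: d] 0.
have {}kP d' : tr k d' <-> agree l d d'.
  rewrite kP; split=> [[t []]|dd']; first by rewrite inE => /eqP->.
  by exists d; rewrite inE.
have uniq d' : tstar X d' -> tr k d' -> d' = d.
  by move=> Xd' /kP dd'; apply/esym/sep => //; [move: Xd|move: Xd']; rewrite sE.
have kd : tr k d by apply/kP => u.
have Nk : N (vset [set k]).
  suff -> : vset [set k] = vadj (vnat k) vempty.
    by apply: model_adj => //; [exact: model_nat|exact: model_empty NT].
  apply: vext => v; rewrite vin_set vin_adj; split=> [[n [-> ->]]|[/vin_empty//|->]].
    by right.
  by exists k.
have NX1 m : N (vset (X `\` [set j | j < m])).
  apply: model_setD => //; suff -> : vset [set j | j < m] = vnat m by exact: model_nat.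
  by apply: vext => v; rewrite vin_set vin_nat.
have fin m (A : set nat) : (forall j, A j -> j < m) -> finite_set A := @bounded_finite_set A m.
have [/finite_set_bound[m mP]|/finite_set_bound[m mP]] := Xd.
  (* If [X] meets [tset d] only below [m], the constraints are the code [k] positively and the codes
     of [X] from [m] on negatively. Any solution is again exceptional for [X]. *)
  apply: (@model_forced N [set k] (X `\` [set j | j < m]) C W) => // d'.
  split=> [[kd' Xd']|->]; last first.
    split=> [_ ->//|j [Xj /negP]]; rewrite -leqNgt => mj jd.
    by have := mP j (conj Xj jd); rewrite ltnNge mj.
  apply: uniq; last exact: kd'.
  left; apply: (fin m) => j [Xj jd']; rewrite ltnNge; apply/negP => mj.
  by apply: (Xd' j) => //; split=> //=; rewrite ltnNge mj.
pose X1 := X `\` [set j | j < m].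
(* In the other case the tail of [X] is contained in [tset d] and joins the positive constraints. *)
apply: (@model_forced N (k |` X1) set0 C W) => //.
- suff -> : vset (k |` X1) = vadj (vnat k) (vset X1).
    by apply: model_adj => //; [exact: model_nat|exact: NX1].
  apply: vext => v; rewrite vin_set vin_adj vin_set.
  split=> [[n [[->|X1n] ->]]|[[n [X1n ->]]|->]].
  + by right.
  + by left; exists n.
  + by exists n; split=> //; right.
  + by exists k; split=> //; left.
- suff -> : vset set0 = vempty by exact: model_empty NT.
  by apply: vext => v; rewrite vin_set; split=> [[n []]|/vin_empty].
move=> d'; split=> [[Xd' _]|->].
  apply: uniq; last by apply: Xd'; left.
  right; apply: (fin m) => j [Xj jd']; rewrite ltnNge; apply/negP => mj.
  by apply: jd'; apply: Xd'; right; split=> //=; rewrite ltnNge mj.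
split=> // j [->//|[Xj /negP]]; rewrite -leqNgt => mj; apply: contrapT => jd.
by have := mP j (conj Xj jd); rewrite ltnNge mj.
Qed.

Lemma run_closed (A : set (set nat)) (s : seq (set nat)) : A setT ->
  (forall x y, A x -> A y -> A (x `\` y)) -> (forall x, x \in s -> A x) -> A (run s).
Proof.
move=> AT AD; elim/last_ind: s => [//|s y IH] sA; rewrite run_rcons.
have Ay : A y by apply: sA; rewrite mem_rcons inE eqxx.
have As : A (run s) by apply: IH => x xs; apply: sA; rewrite mem_rcons inE xs orbT.
rewrite /shrink; case: (pselect _) => ? /=; last exact: AD.
by rewrite -setDD; exact: (AD _ _ As (AD _ _ As Ay)).
Qed.

Lemma tset_infinite d : infinite_set (tset d).
Proof.
apply: infinite_bound => m; have [k [mk kP]] := tr_cylinders 0 [:: d] m.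
by exists k => //; apply/kP; exists d; rewrite inE.
Qed.

Lemma enumerate_reals (M : set V) : countable M -> M (vset setT) ->
  exists g : nat -> set nat, (forall k, M (vset (g k))) /\ forall x, M (vset x) -> exists k, g k = x.
Proof.
move=> /countable_injP[f fI] MT.
(* The default value is a real of [M], so [g] never leaves [M]. *)
pose g n := xget setT [set x | M (vset x) /\ f (vset x) = n].
exists g; split=> [k|x Mx]; first by rewrite /g; case: xgetP => [x _ []|].
exists (f (vset x)); rewrite /g; case: xgetP => [y _ [My fxy]|/(_ x)[]//].
by apply/vset_inj/fI; rewrite ?inE.
Qed.

Lemma generated_refining M g : (forall x, M (vset x) -> exists k, g k = x) ->
  refining_over M (generated g).
Proof. by move=> gM x _ /gM[k <-]; exact: generated_refines. Qed.

Lemma refining_real_exists M : model T0 M -> countable M ->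
  exists r : set nat, infinite_set r /\ refining_over M r /\
    (forall c : nat -> nat, ~ M (vfun c) ->
       forall N : set V, model T0 N -> M `<=` N -> N (vfun c) -> ~ refining_over N r).
Proof.
move=> MT cM; have [g [Mg gM]] := enumerate_reals cM (model_setT MT).
exists (generated g); split; [exact: generated_infinite|split; first exact: generated_refining].
move=> c Mc N NT MN Nc rN; pose d := trace (vfun c).
apply: (@generated_splits g d); last first.
  by apply: rN; [exact: tset_infinite|exact: model_tset].
move=> k Xd; apply/Mc/(@model_vfun M (run (mkseq g k))) => //; last exact: positive_run.
apply: (@run_closed [set x | M (vset x)]) => [|x y|x /mapP[i _ ->]].
- exact: model_setT.
- exact: model_setD.
- exact: Mg.
Qed.

(** * The axioms in V *)

Definition vsep (x : V) (P : V -> Prop) : V :=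
  vsup (fun a : {a : idx x | P (elt a)} => elt (sval a)).

Lemma vin_sep z x P : z ∈ vsep x P <-> z ∈ x /\ P z.
Proof.
rewrite vin_sup; split=> [[[a Pa] <-]|[[a <-] Pa]]; first by split=> //; exists a.
by exists (exist _ a Pa).
Qed.

Definition vunion (x : V) : V :=
  vsup (fun p : {a : idx x & idx (elt a)} => elt (projT2 p)).

Lemma vin_union z x : z ∈ vunion x <-> exists y, y ∈ x /\ z ∈ y.
Proof.
rewrite vin_sup; split=> [[[a b] <-]|[y [[a <-] [b <-]]]].
  by exists (elt a); split; [exists a|exists b].
by exists (existT _ a b).
Qed.

Definition vpow (x : V) : V :=
  vsup (fun S : idx x -> Prop => vsup (fun a : {a : idx x | S a} => elt (sval a))).

Lemma vin_pow z x : z ∈ vpow x <-> forall u, u ∈ z -> u ∈ x.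
Proof.
rewrite vin_sup; split=> [[S <-] u|zx].
  by rewrite vin_sup => -[[a Sa] <-]; exists a.
exists (fun a => elt a ∈ z); apply: vext => u; rewrite vin_sup.
split=> [[[a az] <-]//|uz]; have [a au] := zx u uz; rewrite -au in uz.
by exists (exist _ a uz).
Qed.

Lemma vin_omega z : z ∈ vset setT <-> exists n, z = vnat n.
Proof. by rewrite vin_set; split=> [[n [_ ->]]|[n ->]]; exists n. Qed.

Lemma transitive_setT : transitive_class setT. Proof. by []. Qed.

Lemma closed_setT e : closed_env setT e. Proof. by []. Qed.

#[local] Hint Resolve transitive_setT closed_setT : core.

Lemma V_replacement p : ~~ occurs_free 3 p -> ~~ occurs_free 4 p -> holds setT (ax_repl p).
Proof.
move=> p3 p4 e _ A _ H; pose E x z := sat setT (upd (upd (upd e 2 A) 0 x) 1 z) p.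
pose F x := xget vempty [set z | E x z].
have E1 B z x : sat setT (upd (upd (upd (upd e 2 A) 3 B) 1 z) 0 x) p <-> E x z.
  apply: sat_free => i ip; have i3 : i != 3 by apply/eqP => i3; rewrite -i3 ip in p3.
  by rewrite /upd (negbTE i3); case: (i =P 0) => [->|].
have FE x : x ∈ A -> forall z, E x z <-> z = F x.
  move=> xA; have [y [_ yP]] : sat setT (upd (upd e 2 A) 0 x)
    (FEx 4 (FAll 1 (FIff p (FEq 1 4)))) by exact: (H x I xA).
  have {}yP z : E x z <-> z = y.
    have <- : sat setT (upd (upd (upd (upd e 2 A) 0 x) 4 y) 1 z) p <-> E x z.
      apply: sat_free => i ip; have i4 : i != 4 by apply/eqP => i4; rewrite -i4 ip in p4.
      by rewrite /upd (negbTE i4).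
    by have [H1 H2] := yP z I; split; [exact: H1|exact: H2].
  suff -> : F x = y by [].
  by rewrite /F; case: xgetP => [z _ /yP//|/(_ y)]; rewrite /= yP.
exists (vsup (fun a : idx A => F (elt a))); split=> // z _.
set B := vsup _; split=> [|[x [_ [xA xz]]]].
  rewrite -[X in X -> _]/(z ∈ B) /B vin_sup => -[a az]; exists (elt a); split=> //.
  have aA : elt a ∈ A by exists a.
  by split; [exact: aA|apply/E1/FE].
have {}xA : x ∈ A by exact: xA.
have [a ax] := xA; change (z ∈ B); rewrite /B vin_sup; exists a; rewrite ax.
exact/esym/((FE x xA z).1 ((E1 B z x).1 xz)).
Qed.

Lemma V_DC : holds setT ax_DC.
Proof.
move=> e _ A _ R _ [[x0 [_ x0A]] H].
have {}x0A : x0 ∈ A by exact: x0A.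
have {}H x : x ∈ A -> exists2 y, y ∈ A & vpair x y ∈ R.
  move=> xA; have : sat setT (upd (upd (upd e 0 A) 1 R) 4 x) (FExIn 5 0 (FRel 1 4 5)).
    exact: (H x I xA).
  by rewrite sat_FExIn// => -[y [yA]]; rewrite sat_FRel// => xy; exists y.
pose nxt x := xget x0 [set y | y ∈ A /\ vpair x y ∈ R].
have nxtP x : x ∈ A -> nxt x ∈ A /\ vpair x (nxt x) ∈ R.
  move=> xA; rewrite /nxt; case: xgetP => [y _ //|K].
  by have [y yA xy] := H x xA; case: (K y).
pose s n := iter n nxt x0; have sA n : s n ∈ A.
  by elim: n => [//|n IH]; exact: (nxtP _ IH).1.
have sR n : vpair (s n) (s n.+1) ∈ R by exact: (nxtP _ (sA n)).2.
pose w := vset setT; pose f := vsup (fun n => vpair (vnat n) (s n)).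
have fP z : z ∈ f <-> exists n, z = vpair (vnat n) (s n).
  by rewrite vin_sup; split=> -[n ?]; exists n.
have fs n z : vpair (vnat n) z ∈ f <-> z = s n.
  by rewrite fP; split=> [[m /vpair_inj[/vnat_inj -> ->]]//|->]; exists n.
exists w; split=> //; exists f; split=> //.
set e3 := upd _ 3 f; have e30 : e3 0 = A by []. have e31 : e3 1 = R by [].
have e32 : e3 2 = w by []. have e33 : e3 3 = f by [].
clearbody e3.
rewrite -/sat; split; [|split].
- rewrite /FOmega; split.
    change (sat setT e3 (FInductive 2)); rewrite sat_FInductive// e32.
    split; first by apply/vin_omega; exists 0.
    by move=> x /vin_omega[n ->]; apply/vin_omega; exists n.+1.
  move=> i _; set j := above _ => Hi.
  change (sat setT (upd e3 j i) (FSub 2 j)); rewrite sat_FSub//.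
  have : sat setT (upd e3 j i) (FInductive j) by exact: Hi.
  rewrite sat_FInductive// upd_eq => -[i0 iS] u.
  rewrite /upd /= e32 => /vin_omega[n ->].
  by elim: n => [//|n]; exact: iS.
- change (sat setT e3 (FFun 3 2 0)); rewrite /FFun sat_and; set u := above _.
  have -> : u = 4 by []. split.
    rewrite sat_FAllIn// e33 => z /fP[n zn]; rewrite sat_FExIn//; exists (vnat n); split.
      by rewrite -[X in _ ∈ X]/(e3 2) e32; apply/vin_omega; exists n.
    rewrite sat_FExIn//; exists (s n); split; first by rewrite -[X in _ ∈ X]/(e3 0) e30.
    by rewrite sat_FPair.
  rewrite sat_FAllIn// e32 => x /vin_omega[n xn]; rewrite sat_ex; exists (s n); split=> //.
  rewrite sat_all => z _; rewrite sat_iff sat_FRel// sat_eq.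
  by rewrite -[X in X <-> _]/(vpair x z ∈ e3 3) e33 xn fs.
change (sat setT e3 (FAllIn 4 2 (FExIn 5 2 (FAnd (FSucc 5 4)
            (FEx 6 (FEx 7 (FAnd (FRel 3 4 6)
              (FAnd (FRel 3 5 7) (FRel 1 6 7))))))))).
rewrite sat_FAllIn// e32 => x /vin_omega[n xn]; rewrite sat_FExIn//.
exists (vnat n.+1); split; first by rewrite -[X in _ ∈ X]/(e3 2) e32; apply/vin_omega; exists n.+1.
rewrite sat_and sat_FSucc//; split; first by change (vnat n.+1 = vsucc x); rewrite xn.
rewrite sat_ex; exists (s n); split=> //; rewrite sat_ex; exists (s n.+1); split=> //.
rewrite !sat_and !sat_FRel//.
rewrite -[X in X /\ _]/(vpair x (s n) ∈ e3 3) -[X in _ /\ X /\ _]/(vpair (vnat n.+1) (s n.+1) ∈ e3 3).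
rewrite -[X in _ /\ _ /\ X]/(vpair (s n) (s n.+1) ∈ e3 1) e33 e31 xn.
by split; [|split] => //; apply/fs.
Qed.

Lemma V_ZFDC p : ZFDC p -> holds setT p.
Proof.
case=> [||||||q q2|q q3 q4|].
- move=> e _ x _ y _ H; apply: vext => z; have [H1 H2] := H z I.
  by split; [exact: H1|exact: H2].
- move=> e _ x _ [y [_]]; rewrite -[X in X -> _]/(y ∈ x).
  elim/(well_founded_ind vin_wf): y => y IH yx.
  have [[z [zx zy]]|ny] := pselect (exists z, z ∈ x /\ z ∈ y); first exact: IH zy zx.
  exists y; split=> //; split; first exact: yx.
  by move=> [z [_ [zx zy]]]; apply: ny; exists z.
- move=> e _ x _ y _; exists (vpair2 x y); split=> //.
  by change (sat setT (upd (upd (upd e 0 x) 1 y) 2 (vpair2 x y)) (FPair2 2 0 1)); rewrite sat_FPair2.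
- move=> e _ x _; exists (vunion x); split=> // z _.
  change (sat setT (upd (upd (upd e 0 x) 1 (vunion x)) 2 z)
    (FIff (FMem 2 1) (FExIn 3 0 (FMem 2 3)))); rewrite sat_iff sat_FExIn//; exact: vin_union.
- move=> e _ x _; exists (vpow x); split=> // z _.
  change (sat setT (upd (upd (upd e 0 x) 1 (vpow x)) 2 z)
    (FIff (FMem 2 1) (FSub 2 0))); rewrite sat_iff sat_FSub//; exact: vin_pow.
- move=> e _; exists (vset setT); split=> //.
  change (sat setT (upd e 0 (vset setT)) (FInductive 0)); rewrite sat_FInductive//.
  rewrite upd_eq; split; first by apply/vin_omega; exists 0.
  by move=> x /vin_omega[n ->]; apply/vin_omega; exists n.+1.
- move=> e _ x _; pose y := vsep x (fun z => sat setT (upd (upd e 1 x) 0 z) q).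
  exists y; split=> // z _.
  have E : sat setT (upd (upd e 1 x) 0 z) q <-> sat setT (upd (upd (upd e 1 x) 2 y) 0 z) q.
    apply: sat_free => i iq; have i2 : i != 2 by apply/eqP => i2; rewrite -i2 iq in q2.
    by rewrite /upd (negbTE i2).
  change (sat setT (upd (upd (upd e 1 x) 2 y) 0 z)
    (FIff (FMem 0 2) (FAnd (FMem 0 1) q))); rewrite sat_iff sat_and !sat_mem -(propext E).
  exact: vin_sep.
- exact: V_replacement.
- exact: V_DC.
Qed.

(** * Countable elementary submodels and their collapse *)

(** An embedding of formulas into a countable type, so that the Skolem functions can be numbered. *)
Fixpoint fml_tree (p : fml) : GenTree.tree nat :=
  match p with
  | FMem i j => GenTree.Node 0 [:: GenTree.Leaf i; GenTree.Leaf j]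
  | FEq i j => GenTree.Node 1 [:: GenTree.Leaf i; GenTree.Leaf j]
  | FNot p => GenTree.Node 2 [:: fml_tree p]
  | FAnd p q => GenTree.Node 3 [:: fml_tree p; fml_tree q]
  | FOr p q => GenTree.Node 4 [:: fml_tree p; fml_tree q]
  | FImp p q => GenTree.Node 5 [:: fml_tree p; fml_tree q]
  | FAll i p => GenTree.Node 6 [:: GenTree.Leaf i; fml_tree p]
  | FEx i p => GenTree.Node 7 [:: GenTree.Leaf i; fml_tree p]
  end.

Lemma fml_tree_inj : injective fml_tree.
Proof.
elim=> [i j|i j|p IH|p IHp q IHq|p IHp q IHq|p IHp q IHq|i p IH|i p IH] [] //=;
  by [move=> ? ? [-> ->]|move=> ? [/IH ->]|move=> ? ? [/IHp -> /IHq ->]|move=> ? ? [-> /IH ->]].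
Qed.

Fixpoint var_bound (p : fml) : nat :=
  match p with
  | FMem i j | FEq i j => (maxn i j).+1
  | FNot p => var_bound p
  | FAnd p q | FOr p q | FImp p q => maxn (var_bound p) (var_bound q)
  | FAll i p | FEx i p => maxn i.+1 (var_bound p)
  end.

Lemma occurs_free_bound i p : occurs_free i p -> i < var_bound p.
Proof.
elim: p => //= [j k|j k|p IHp q IHq|p IHp q IHq|p IHp q IHq|j p IH|j p IH].
- by case/orP=> /eqP ->; rewrite ltnS ?leq_maxl ?leq_maxr.
- by case/orP=> /eqP ->; rewrite ltnS ?leq_maxl ?leq_maxr.
- by case/orP=> [/IHp|/IHq] H; rewrite leq_max H ?orbT.
- by case/orP=> [/IHp|/IHq] H; rewrite leq_max H ?orbT.
- by case/orP=> [/IHp|/IHq] H; rewrite leq_max H ?orbT.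
- by case/andP=> _ /IH H; rewrite leq_max H orbT.
- by case/andP=> _ /IH H; rewrite leq_max H orbT.
Qed.

(** Parameters come as a list, a finite part of the environment completed by [vempty]; the variables
    below [var_bound p] suffice. *)
Definition skolem (i : nat) (p : fml) (s : seq V) : V :=
  xget vempty [set x | sat setT (upd (nth vempty s) i x) p].

Lemma skolemP i p s : (exists x, sat setT (upd (nth vempty s) i x) p) ->
  sat setT (upd (nth vempty s) i (skolem i p s)) p.
Proof. by move=> [x px]; rewrite /skolem; case: xgetP => [y _|/(_ x)]. Qed.

Definition closed_under (H : set V) (f : seq V -> V) : Prop :=
  forall s, (forall x, x \in s -> H x) -> H (f s).

(** The hull consists of the values of finite trees whose nodes are labelled by indices of
    operations, and there are countably many such trees. *)
Lemma countable_hull (f : nat -> seq V -> V) :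
  exists H : set V, countable H /\ forall n, closed_under H (f n).
Proof.
pose ev := fix ev (t : GenTree.tree nat) : V := match t with
  | GenTree.Leaf n => f n [::]
  | GenTree.Node n ts => f n (map ev ts)
  end.
exists (range ev); split.
  by apply: card_le_trans (card_image_le _ _) _; exact: countableP.
move=> n s sH; have [ts <-] : exists ts, map ev ts = s.
  elim: s sH => [|x s IH] sH; first by exists [::].
  have [t _ tx] : range ev x by apply: sH; rewrite inE eqxx.
  have [|ts tss] := IH; first by move=> y ys; apply: sH; rewrite inE ys orbT.
  by exists (t :: ts); rewrite /= tx tss.
by exists (GenTree.Node n ts).
Qed.

Definition elementary (H : set V) : Prop :=
  forall p e, closed_env H e -> (sat H e p <-> sat setT e p).

(** This is the Tarski-Vaught criterion; the universal quantifier uses a Skolem witness of the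
    negated formula. *)
Lemma skolem_elementary (H : set V) : (forall i p, closed_under H (skolem i p)) -> elementary H.
Proof.
move=> Hsk.
have wit i p e : closed_env H e -> (exists x, sat setT (upd e i x) p) ->
    exists x, H x /\ sat setT (upd e i x) p.
  move=> He [x px]; pose s := mkseq e (var_bound p).
  have E y : sat setT (upd (nth vempty s) i y) p <-> sat setT (upd e i y) p.
    apply: sat_free => j /occurs_free_bound jp; rewrite /upd; case: eqP => // _.
    by rewrite nth_mkseq.
  exists (skolem i p s); split; first by apply: Hsk => y /mapP[j _ ->].
  by apply/E/skolemP; exists x; apply/E.
elim=> [i j|i j|p IH|p IHp q IHq|p IHp q IHq|p IHp q IHq|i p IH|i p IH] e He //.
- by rewrite !sat_not (propext (IH e He)).
- by rewrite !sat_and (propext (IHp e He)) (propext (IHq e He)).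
- by rewrite !sat_or (propext (IHp e He)) (propext (IHq e He)).
- by rewrite !sat_imp (propext (IHp e He)) (propext (IHq e He)).
- rewrite !sat_all; split=> K x; last first.
    by move=> Hx; apply/(IH _ (closed_upd i He Hx)); exact: K.
  move=> _; apply: contrapT => nx; have [|y [Hy]] := wit i (FNot p) e He; first by exists x.
  by rewrite sat_not; apply; apply/(IH _ (closed_upd i He Hy)); exact: K.
- rewrite !sat_ex; split=> [[x [Hx px]]|[x [_ px]]].
    by exists x; split=> //; apply/(IH _ (closed_upd i He Hx)).
  have [|y [Hy py]] := wit i p e He; first by exists x.
  by exists y; split=> //; apply/(IH _ (closed_upd i He Hy)).
Qed.

(** The Mostowski collapse: recursively, only the elements belonging to [H] are kept. *)
Definition collapse (H : set V) : V -> V :=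
  Fix vin_wf (fun _ => V) (fun x rec => vsup (fun a : {a : idx x | H (elt a)} =>
    rec (elt (sval a)) (ex_intro _ (sval a) erefl))).

Lemma collapseE H z x : z ∈ collapse H x <-> exists y, [/\ y ∈ x, H y & z = collapse H y].
Proof.
have -> : collapse H x =
    vsup (fun a : {a : idx x | H (elt a)} => collapse H (elt (sval a))).
  rewrite /collapse Fix_eq// => t f g fg; congr vsup.
  by apply/funext => a; rewrite fg.
rewrite vin_sup; split=> [[[a Ha] <-]|[y [[a <-] Ha ->]]].
  by exists (elt a); split=> //; exists a.
by exists (exist _ a Ha).
Qed.

(** By elementarity, two members of [H] with the same elements in [H] are equal. *)
Lemma collapse_inj H x y : elementary H -> H x -> H y -> collapse H x = collapse H y -> x = y.
Proof.
move=> elH; elim/(well_founded_ind vin_wf): x y => x IH y Hx Hy xy.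
have He : closed_env H (upd (upd (fun=> x) 0 x) 1 y) by do 2 apply: closed_upd => //.
have [+ _] := elH (FAll 2 (FIff (FMem 2 0) (FMem 2 1))) _ He.
rewrite !sat_all => K; apply: vext => z; apply: (K _ z I) => u Hu.
change (u ∈ x <-> u ∈ y); split=> ut.
  have : collapse H u ∈ collapse H y by rewrite -xy; apply/collapseE; exists u.
  by move=> /collapseE[v [vy Hv /(IH u ut v Hu Hv) ->]].
have : collapse H u ∈ collapse H x by rewrite xy; apply/collapseE; exists u.
by move=> /collapseE[v [vx Hv /esym/(IH v vx u Hv Hu) <-]].
Qed.

Lemma sat_collapse H p e : elementary H -> closed_env H e ->
  sat (collapse H @` H) (collapse H \o e) p <-> sat H e p.
Proof.
move=> elH; have updc (e' : nat -> V) i x :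
    collapse H \o upd e' i x = upd (collapse H \o e') i (collapse H x).
  by apply/funext => j; rewrite /upd /=; case: eqP.
elim: p e => [i j|i j|p IH|p IHp q IHq|p IHp q IHq|p IHp q IHq|i p IH|i p IH] e He.
- rewrite !sat_mem /= collapseE; split=> [[y [ye Hy]]|]; last by exists (e i).
  by move=> /(collapse_inj elH (He i) Hy) ->.
- rewrite !sat_eq /=; split=> [|->//]; exact: collapse_inj.
- by rewrite !sat_not (propext (IH e He)).
- by rewrite !sat_and (propext (IHp e He)) (propext (IHq e He)).
- by rewrite !sat_or (propext (IHp e He)) (propext (IHq e He)).
- by rewrite !sat_imp (propext (IHp e He)) (propext (IHq e He)).
- rewrite !sat_all; split=> K x.
    by move=> Hx; apply/(IH _ (closed_upd i He Hx)); rewrite updc; apply: K; exists x.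
  by move=> [y Hy <-]; rewrite -updc; apply/(IH _ (closed_upd i He Hy)); exact: K.
- rewrite !sat_ex; split=> [[_ [[y Hy <-] py]]|[x [Hx px]]].
    by exists y; split=> //; apply/(IH _ (closed_upd i He Hy)); rewrite updc.
  exists (collapse H x); split; first by exists x.
  by rewrite -updc; apply/(IH _ (closed_upd i He Hx)).
Qed.

Lemma countable_elementary (f : nat * nat -> seq V -> V) :
  exists H : set V, [/\ countable H, elementary H & forall j, closed_under H (f j)].
Proof.
(* A left inverse of [fml_tree], arbitrary outside its range. *)
have /choice[dec decP] t : exists p, forall q, fml_tree q = t -> q = p.
  have [[p <-]|nt] := pselect (exists p, fml_tree p = t); first by exists p => q /fml_tree_inj.
  by exists (FEq 0 0) => q qt; case: nt; exists q.
pose g n s := match unpickle n : option ((nat * nat) + (nat * GenTree.tree nat)) with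
  | Some (inl j) => f j s
  | Some (inr (i, t)) => skolem i (dec t) s
  | None => vempty end.
have [H [cH Hg]] := countable_hull g; exists H; split=> //; last first.
  move=> j s sH; have := Hg (pickle (inl j : (nat * nat) + (nat * GenTree.tree nat))) s sH.
  by rewrite /g pickleK.
apply: skolem_elementary => i p s sH.
have := Hg (pickle (inr (i, fml_tree p) : (nat * nat) + (nat * GenTree.tree nat))) s sH.
by rewrite /g pickleK -(decP _ p erefl).
Qed.

Lemma collapse_model (H : set V) (T : set fml) : H !=set0 -> elementary H ->
  T `<=` ZFDC -> model T (collapse H @` H).
Proof.
move=> [x Hx] elH TZ; split; first by exists (collapse H x), x.
  by move=> u v uv [y Hy yv]; move: uv; rewrite -yv => /collapseE[w [wy Hw ->]]; exists w.
move=> p /TZ /V_ZFDC Vp e eM.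
have /choice[e' e'P] i : exists y, H y /\ collapse H y = e i.
  by have [y Hy ye] := eM i; exists y.
have -> : e = collapse H \o e' by apply/funext => i /=; rewrite (e'P i).2.
have He : closed_env H e' by move=> i; exact: (e'P i).1.
by apply/(sat_collapse p elH He)/(elH p e' He); exact: Vp.
Qed.

(** * Forcing over a collapse *)

(** The canonical name of the natural number [n], with every entry carrying the condition [t], in
    practice the greatest one. *)
Fixpoint check (t : V) (n : nat) : V :=
  if n is m.+1 then vadj (vpair (check t m) t) (check t m) else vempty.

Lemma vin_check z t n : z ∈ check t n <-> exists i, i < n /\ z = vpair (check t i) t.
Proof.
elim: n => [|n IH] /=; first by split=> [/vin_empty//|[]// i []].
rewrite vin_adj IH; split=> [[[i [ik ->]]|->]|[i [+ ->]]].
- by exists i; split=> //; exact: ltnW.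
- by exists n.
- by rewrite ltnS leq_eqVlt => /orP[/eqP ->|ik]; [right|left; exists i].
Qed.

Lemma check_name P t n : t ∈ P -> is_name P (check t n).
Proof.
move=> tP; elim/ltn_ind: n => n IH; constructor=> z /vin_check[i [ik ->]].
by exists (check t i), t; split=> //; exact: IH.
Qed.

Lemma vval_check G t n : t ∈ G -> vval G (check t n) = vnat n.
Proof.
move=> tG; elim/ltn_ind: n => n IH; apply: vext => z; rewrite vvalE vin_nat.
split=> [[s [p [pG /vin_check[i [ik /vpair_inj[-> _]]] ->]]]|[i [ik ->]]].
  by exists i; rewrite IH.
by exists (check t i), t; split=> //; [apply/vin_check; exists i|rewrite IH].
Qed.

Definition good_hull (H : set V) : Prop :=
  [/\ elementary H, forall n, H (vnat n),
    forall x y, H x -> H y -> H (vpair2 x y),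
    forall x y, H (vpair x y) -> H x /\ H y &
    forall t n, H t -> H (check t n)].

Lemma hull_pair H x y : good_hull H -> H x -> H y -> H (vpair x y).
Proof. by move=> [_ _ H2 _ _] Hx Hy; do !apply: (H2). Qed.

Lemma collapse_id H x : (forall y, y ∈ x -> H y /\ collapse H y = y) -> collapse H x = x.
Proof.
move=> Hx; apply: vext => z; rewrite collapseE; split=> [[y [yx _ ->]]|zx].
  by rewrite (Hx y yx).2.
by exists z; have [Hz zz] := Hx z zx.
Qed.

Lemma collapse_vnat H n : good_hull H -> collapse H (vnat n) = vnat n.
Proof.
move=> [_ Hn _ _ _]; elim/ltn_ind: n => n IH; apply: collapse_id => y /vin_nat[m [mn ->]].
by split; [exact: Hn|exact: IH].
Qed.

Lemma collapse_vset H x : good_hull H -> collapse H (vset x) = vset x.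
Proof.
move=> GH; apply: collapse_id => y /vin_set[n [_ ->]]; have [_ Hn _ _ _] := GH.
by split=> //; exact: collapse_vnat.
Qed.

Lemma collapse_pair2 H x y : H x -> H y ->
  collapse H (vpair2 x y) = vpair2 (collapse H x) (collapse H y).
Proof.
move=> Hx Hy; apply: vext => z; rewrite collapseE vin_pair2.
split=> [[u [/vin_pair2[->|->] _ ->]]|[->|->]]; [by left|by right| |].
  by exists x; split=> //; apply/vin_pair2; left.
by exists y; split=> //; apply/vin_pair2; right.
Qed.

Lemma collapse_pair H x y : good_hull H -> H x -> H y ->
  collapse H (vpair x y) = vpair (collapse H x) (collapse H y).
Proof.
move=> [_ _ H2 _ _] Hx Hy; rewrite /vpair.
by rewrite !collapse_pair2//; exact: H2.
Qed.

Lemma collapse_check H t n : good_hull H -> H t -> collapse H t = t ->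
  collapse H (check t n) = check t n.
Proof.
move=> GH Ht tt; have [_ _ _ _ Hc] := GH.
elim/ltn_ind: n => n IH; apply: collapse_id => y /vin_check[i [ik ->]].
have Hi : H (check t i) by exact: Hc.
by split; [exact: hull_pair|rewrite collapse_pair// IH// tt].
Qed.

Definition vcond (A : Type) (enc : A -> V) : V := vsup enc.

Definition vle (A : Type) (enc : A -> V) (le : A -> A -> Prop) : V :=
  vsup (fun p : {p : A * A | le p.1 p.2} => vpair (enc (sval p).1) (enc (sval p).2)).

Definition vdense (A : Type) (enc : A -> V) (P : A -> Prop) : V :=
  vsup (fun a : {a : A | P a} => enc (sval a)).

(** A name for the set of all [k] such that [F a k] for some condition [a] of the generic filter. *)
Definition vname (A : Type) (enc : A -> V) (top : A) (F : A -> nat -> Prop) : V :=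
  vsup (fun p : {p : A * nat | F p.1 p.2} =>
    vpair (check (enc top) (sval p).2) (enc (sval p).1)).

(** Forcings are defined in [V] from a type of conditions and then collapsed. As [good_poset] makes
    the collapse fix every condition of [H], the conditions of the result are exactly the encodings
    that lie in [H]. *)
Definition hull_forcing (H : set V) (A : Type) (enc : A -> V) (le : A -> A -> Prop) (top : A) :=
  Forcing (collapse H (vcond enc)) (collapse H (vle enc le)) (enc top).

Definition good_poset (H : set V) (A : Type) (enc : A -> V) (le : A -> A -> Prop) (top : A) :=
  [/\ injective enc,
    [/\ forall a, le a a, forall a b c, le a b -> le b c -> le a c & forall a, le a top],
    H (enc top),
    H (vcond enc) /\ H (vle enc le) &
    forall a, H (enc a) -> collapse H (enc a) = enc a].

Lemma vin_cond H A (enc : A -> V) le top z : good_poset H enc le top ->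
  z ∈ cond (hull_forcing H enc le top) <-> exists a, H (enc a) /\ z = enc a.
Proof.
move=> [_ _ _ _ cid]; rewrite /= collapseE; split=> [[y [/vin_sup[a <-] Ha ->]]|[a [Ha ->]]].
  by exists a; rewrite cid.
by exists (enc a); rewrite cid//; split=> //; apply/vin_sup; exists a.
Qed.

Lemma vin_le H A (enc : A -> V) le top z : good_hull H -> good_poset H enc le top ->
  z ∈ Defs.le (hull_forcing H enc le top) <->
  exists a b, [/\ H (enc a), H (enc b), le a b & z = vpair (enc a) (enc b)].
Proof.
move=> GH [_ _ _ _ cid]; have [_ _ _ Hp _] := GH; rewrite /= collapseE; split.
  move=> [y [/vin_sup[[[a b] /= ab] <-] /Hp[Ha Hb] ->]].
  by exists a, b; split=> //; rewrite collapse_pair// !cid.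
move=> [a [b [Ha Hb ab ->]]]; exists (vpair (enc a) (enc b)).
rewrite collapse_pair// !cid//; split=> //; last exact: hull_pair.
by apply/vin_sup; exists (exist _ (a, b) ab).
Qed.

Lemma fle_enc H A (enc : A -> V) le top a b : good_hull H -> good_poset H enc le top ->
  H (enc a) -> H (enc b) -> fle (hull_forcing H enc le top) (enc a) (enc b) <-> le a b.
Proof.
move=> GH GP Ha Hb; rewrite /fle vin_le//; have [ei _ _ _ _] := GP.
by split=> [[a' [b' [_ _ + /vpair_inj[/ei -> /ei ->]]]]//|ab]; exists a, b.
Qed.

Lemma hull_is_forcing H A (enc : A -> V) le top : good_hull H -> good_poset H enc le top ->
  is_forcing (hull_forcing H enc le top).
Proof.
move=> GH GP; have [ei [lxx ltr ltop] Ht _ _] := GP; split.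
- move=> z /(vin_le _ GH GP)[a [b [Ha Hb ab ->]]]; exists (enc a), (enc b).
  by split=> //; apply/(vin_cond _ GP); [exists a|exists b].
- by move=> p /(vin_cond _ GP)[a [Ha ->]]; apply/(fle_enc GH GP).
- move=> p q s /(vin_le _ GH GP)[a [b [Ha Hb ab /vpair_inj[-> ->]]]].
  move=> /(vin_le _ GH GP)[b' [c [Hb' Hc bc /vpair_inj[/ei eb ->]]]].
  by apply/(fle_enc GH GP) => //; apply: ltr ab _; rewrite eb.
- by apply/(vin_cond _ GP); exists top.
- by move=> p /(vin_cond _ GP)[a [Ha ->]]; apply/(fle_enc GH GP).
Qed.

Lemma hull_forcing_in H A (enc : A -> V) le top : good_hull H -> good_poset H enc le top ->
  (collapse H @` H) (vforcing (hull_forcing H enc le top)).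
Proof.
move=> GH [_ _ Ht [Hc Hl] cid].
exists (vpair (vcond enc) (vpair (vle enc le) (enc top))); first by do !apply: hull_pair.
rewrite collapse_pair//; last exact: hull_pair.
by rewrite collapse_pair// (cid _ Ht).
Qed.

Lemma vdense_in H A (enc : A -> V) le top (P : A -> Prop) : good_poset H enc le top ->
  forall z, z ∈ collapse H (vdense enc P) <-> exists a, [/\ H (enc a), P a & z = enc a].
Proof.
move=> [_ _ _ _ cid] z; rewrite collapseE; split=> [[y [/vin_sup[[a Pa] <-] /= Ha ->]]|[a [Ha Pa ->]]].
  by exists a; rewrite cid.
by exists (enc a); rewrite cid//; split=> //; apply/vin_sup; exists (exist _ a Pa).
Qed.

(** The dense set is defined in [V], and it is its collapse that the generic filter meets; density
    is to be checked on the conditions of [H] only. *)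
Lemma generic_meets H A (enc : A -> V) le top (P : A -> Prop) G :
  good_hull H -> good_poset H enc le top -> H (vdense enc P) ->
  generic (collapse H @` H) (hull_forcing H enc le top) G ->
  (forall a, H (enc a) -> exists b, [/\ H (enc b), P b & le b a]) ->
  exists a, [/\ H (enc a), P a & enc a ∈ G].
Proof.
move=> GH GP HP [_ Gen] dP; have [p [pG]] : exists p, p ∈ G /\ p ∈ collapse H (vdense enc P).
  apply: Gen; first by exists (vdense enc P).
  split=> [d /(vdense_in _ GP)[a [Ha _ ->]]|p /(vin_cond _ GP)[a [Ha ->]]].
    by apply/(vin_cond _ GP); exists a.
  have [b [Hb Pb ba]] := dP a Ha; exists (enc b); split.
    by apply/(vdense_in _ GP); exists b.
  exact/(fle_enc GH GP).
by move=> /(vdense_in _ GP)[a [Ha Pa pa]]; exists a; split=> //; rewrite -pa.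
Qed.

(** The collapse fixes conditions and check names, so it only removes from [vname] the entries whose
    condition is outside [H]. *)
Lemma extension_real H A (enc : A -> V) le top (F : A -> nat -> Prop) G :
  good_hull H -> good_poset H enc le top -> H (vname enc top F) -> enc top ∈ G ->
  (forall p, p ∈ G -> p ∈ cond (hull_forcing H enc le top)) ->
  extension (collapse H @` H) (hull_forcing H enc le top) G
    (vset [set k | exists a, [/\ H (enc a), enc a ∈ G & F a k]]).
Proof.
move=> GH GP HF tG Gc; have [ei _ Ht _ cid] := GP; have [_ _ _ Hp Hch] := GH.
have nP z : z ∈ collapse H (vname enc top F) <->
    exists k a, [/\ H (enc a), F a k & z = vpair (check (enc top) k) (enc a)].
  have E k a : H (enc a) -> collapse H (vpair (check (enc top) k) (enc a)) =
      vpair (check (enc top) k) (enc a).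
    by move=> Ha; rewrite collapse_pair// ?collapse_check ?cid//; exact: Hch.
  rewrite collapseE; split=> [[y [/vin_sup[[[a k] /= Fa] <-] /Hp[_ Ha] ->]]|[k [a [Ha Fa ->]]]].
    by exists k, a; split=> //; exact: E.
  exists (vpair (check (enc top) k) (enc a)); rewrite E//; split=> //.
    by apply/vin_sup; exists (exist _ (a, k) Fa).
  by apply: hull_pair => //; exact: Hch.
exists (collapse H (vname enc top F)).
  split; first by exists (vname enc top F).
  constructor=> z /nP[k [a [Ha _ ->]]]; exists (check (enc top) k), (enc a); split=> //.
    by apply: check_name; apply/(vin_cond _ GP); exists top.
  by apply/(vin_cond _ GP); exists a.
apply: vext => z; rewrite vvalE vin_set; split.
  move=> [s [p [pG /nP[k [a [Ha Fa /vpair_inj[-> pa]]]] ->]]].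
  by exists k; rewrite vval_check//; split=> //; exists a; split=> //; rewrite -pa.
move=> [k [[a [Ha aG Fa]] ->]]; exists (check (enc top) k), (enc a).
by split=> //; [apply/nP; exists k, a|rewrite vval_check].
Qed.

(** * The two forcing notions *)

Definition extends (T : Type) (a b : seq T) : Prop := take (size b) a = b.

Lemma extends_size T (a b : seq T) : extends a b -> size b <= size a.
Proof. by move=> <-; rewrite size_take; case: ltnP => // /ltnW. Qed.

Lemma extends_refl T (a : seq T) : extends a a.
Proof. exact: take_size. Qed.

Lemma extends_trans T (a b c : seq T) : extends a b -> extends b c -> extends a c.
Proof. by move=> ab bc; rewrite /extends -[RHS]bc -ab take_takel// extends_size. Qed.

Lemma extends_nil T (a : seq T) : extends a [::].
Proof. exact: take0. Qed.

Lemma extends_cat T (a s : seq T) : extends (a ++ s) a.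
Proof. exact: take_size_cat. Qed.

Lemma extends_nth T (x : T) (a b : seq T) i : extends a b -> i < size b -> nth x a i = nth x b i.
Proof. by move=> ab ib; rewrite -[in RHS]ab nth_take. Qed.

Lemma take_mkseq_le T (f : nat -> T) m n : m <= n -> take m (mkseq f n) = mkseq f m.
Proof. by move=> mn; rewrite /mkseq -map_take take_iota (minn_idPl mn). Qed.

Lemma extends_mkseq T (f : nat -> T) m n : m <= n -> extends (mkseq f n) (mkseq f m).
Proof. by move=> mn; rewrite /extends size_mkseq take_mkseq_le. Qed.

(* [nat -> Prop] instead of [set nat] keeps the index types of [vsup] small enough. *)
Definition encode (a : seq (nat -> Prop)) : V := foldr (fun x v => vpair (vset x) v) vempty a.

Lemma vpair_neq_empty x y : vpair x y <> vempty.
Proof. by have [w [wxy _]] := vpair_fst x y; move=> e; rewrite e in wxy; exact: vin_empty wxy. Qed.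

Lemma encode_inj : injective encode.
Proof.
elim=> [|x a IH] [|y b] //= => [/esym/vpair_neq_empty//|/vpair_neq_empty//|].
by move=> /vpair_inj[/vset_inj -> /IH ->].
Qed.

(** Cohen conditions are coded by natural numbers, so all of them lie in [H] and are fixed by the
    collapse. *)
Definition encode_bits (s : seq bool) : V := vnat (pickle s).

Lemma encode_bits_inj : injective encode_bits.
Proof. by move=> s t /vnat_inj/(pcan_inj pickleK). Qed.

Definition nset (v : V) : set nat := [set n | vnat n ∈ v].

Lemma nset_vset x : nset (vset x) = x.
Proof. by apply/predeqP => n; exact: vnat_in_set. Qed.

Definition vsnd (z : V) : V := xget vempty [set y | exists x, z = vpair x y].

Lemma vsnd_pair x y : vsnd (vpair x y) = y.
Proof.
rewrite /vsnd; case: xgetP => [_ -> [x' /vpair_inj[]]//|].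
by move=> /(_ y) []; exists x.
Qed.

(** A list of the finite exceptional set, so that the hull can reach each of its points by an
    index. *)
Definition tstar_seq (X : set nat) : seq (set nat) := xget [::] [set s | tstar X = [set` s]].

Lemma tstar_seqP X d : positive X -> tstar X d -> exists i, nth set0 (tstar_seq X) i = d.
Proof.
move=> /positive_finite/finite_seqP[s sE]; rewrite /tstar_seq.
case: xgetP => [t _ /= tE|/(_ s)//]; rewrite tE => /= dt.
by exists (index d t); rewrite nth_index.
Qed.

(** The condition [a] puts [k] into the generated set: block [j] depends on the first [j.+1] reals
    only. *)
Definition block_forced (a : seq (nat -> Prop)) (k : nat) : Prop :=
  exists2 j, j < size a & block j (run (take j a)) (run (take j.+1 a)) k.

Definition tr_forced (s : seq bool) (k : nat) : Prop :=
  forall d : set nat, (forall i, i < size s -> (d i <-> nth false s i)) -> tr k d.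

(** [j.1] selects the operation and [j.2] is a numerical parameter. Operations 0 to 4 give
    [good_hull], 5 and 6 the reals needed by [run], 7 the exceptional points; 8 to 10 give the
    collapse of the continuum and the name of the refining set, 11 to 13 Cohen forcing and the name
    of [tset d]. The last two are dense sets of Cohen forcing: one makes the generic sequence long,
    the other makes it differ from a given real. *)
Definition op (j : nat * nat) (s : seq V) : V :=
  let x := nth vempty s 0 in let y := nth vempty s 1 in
  match j.1 with
  | 0 => vnat j.2
  | 1 => vpair2 x y
  | 2 => vfst x
  | 3 => vsnd x
  | 4 => check x j.2
  | 5 => vset setT
  | 6 => vset (nset x `\` nset y)
  | 7 => vset (nth set0 (tstar_seq (nset x)) j.2)
  | 8 => vcond encode
  | 9 => vle encode (@extends _)
  | 10 => vname encode [::] block_forced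
  | 11 => vcond encode_bits
  | 12 => vle encode_bits (@extends _)
  | 13 => vname encode_bits [::] tr_forced
  | 14 => vdense encode_bits (fun s => j.2 <= size s)
  | _ => vdense encode_bits (fun s => exists2 i, i < size s & ~ (nth false s i <-> nset x i))
  end.

(** * Hulls closed under the operations and the two generic objects *)

Definition op_hull (H : set V) : Prop := elementary H /\ forall j, closed_under H (op j).

Lemma op_hull0 H j : op_hull H -> H (op j [::]).
Proof. by move=> [_ Hop]; apply: Hop. Qed.

Lemma op_hull1 H j x : op_hull H -> H x -> H (op j [:: x]).
Proof. by move=> [_ Hop] Hx; apply: Hop => y; rewrite inE => /eqP->. Qed.

Lemma op_hull2 H j x y : op_hull H -> H x -> H y -> H (op j [:: x; y]).
Proof. by move=> [_ Hop] Hx Hy; apply: Hop => z; rewrite !inE => /orP[]/eqP->. Qed.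

Lemma op_good H : op_hull H -> good_hull H.
Proof.
move=> HH; split; first by have [] := HH.
- by move=> n; exact: (op_hull0 (0, n) HH).
- by move=> x y; exact: (op_hull2 (1, 0) HH).
- move=> x y Hxy; split.
    by have := op_hull1 (2, 0) HH Hxy; rewrite /op /= vfst_pair.
  by have := op_hull1 (3, 0) HH Hxy; rewrite /op /= vsnd_pair.
- by move=> t n; exact: (op_hull1 (4, n) HH).
Qed.

Lemma op_setD H x y : op_hull H -> H (vset x) -> H (vset y) -> H (vset (x `\` y)).
Proof.
by move=> HH Hx Hy; have := op_hull2 (6, 0) HH Hx Hy; rewrite /op /= !nset_vset.
Qed.

Lemma op_tstar H X d : op_hull H -> H (vset X) -> positive X -> tstar X d -> H (vset d).
Proof.
move=> HH HX pX /(tstar_seqP pX)[i <-].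
by have := op_hull1 (7, i) HH HX; rewrite /op /= nset_vset.
Qed.

Lemma op_real H x : op_hull H -> (collapse H @` H) (vset x) <-> H (vset x).
Proof.
move=> HH; have GH := op_good HH; have [elH Hn _ _ _] := GH.
split=> [[y Hy yx]|Hx]; last by exists (vset x); rewrite ?collapse_vset.
(* Subtracting [vnat 0], which is empty, makes operation 6 return the set of naturals in [y]; this
   set is [x], as the collapse fixes the naturals. *)
have := op_hull2 (6, 0) HH Hy (Hn 0); rewrite /op /=; congr (H (vset _)).
apply/predeqP => n; rewrite -(vnat_in_set n x) -yx collapseE; split=> [[ny _]|[z [zy Hz]]].
  by exists (vnat n); rewrite collapse_vnat.
rewrite -(collapse_vnat n GH) => /(collapse_inj elH (Hn n) Hz) zn.
by rewrite -zn in zy; split=> //; exact: vin_empty.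
Qed.

Lemma op_encode H a : op_hull H -> H (encode a) <-> forall i, H (vset (nth setT a i)).
Proof.
move=> HH; have GH := op_good HH; have HT : H (vset setT) := op_hull0 (5, 0) HH.
have [_ Hn _ Hp _] := GH.
elim: a => [|x a IH]; first by split=> [_ i|_]; [rewrite nth_nil|exact: (Hn 0)].
split=> [/Hp[Hx /IH Ha] [|i]//|Hxa]; first exact: Ha.
by apply: hull_pair => //; [exact: (Hxa 0)|apply/IH => i; exact: (Hxa i.+1)].
Qed.

Lemma op_poset H : op_hull H -> good_poset H encode (@extends _) [::].
Proof.
move=> HH; have GH := op_good HH; split.
- exact: encode_inj.
- split; [exact: extends_refl|exact: extends_trans|exact: extends_nil].
- exact: (op_hull0 (0, 0) HH).
- by split; [exact: (op_hull0 (8, 0) HH)|exact: (op_hull0 (9, 0) HH)].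
elim=> [_|x a IH /= Hxa]; first exact: (collapse_vnat 0).
have [_ _ _ Hp _] := GH; have [Hx Ha] := Hp _ _ Hxa.
by rewrite collapse_pair// collapse_vset// IH.
Qed.

Lemma op_poset_bits H : op_hull H -> good_poset H encode_bits (@extends _) [::].
Proof.
move=> HH; have GH := op_good HH; have [_ Hn _ _ _] := GH; split.
- exact: encode_bits_inj.
- split; [exact: extends_refl|exact: extends_trans|exact: extends_nil].
- exact: Hn.
- by split; [exact: (op_hull0 (11, 0) HH)|exact: (op_hull0 (12, 0) HH)].
- by move=> s _; exact: collapse_vnat.
Qed.

Lemma countable_enum (M : set V) : countable M -> M !=set0 ->
  exists h : nat -> V, (forall n, M (h n)) /\ forall x, M x -> exists n, h n = x.
Proof.
move=> /countable_injP[f fI] [x0 Mx0].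
pose h n := xget x0 [set x | M x /\ f x = n].
exists h; split=> [k|x Mx]; first by rewrite /h; case: xgetP => [x _ []|].
exists (f x); rewrite /h; case: xgetP => [y _ [My fxy]|/(_ x)[]//].
by apply: fI; rewrite ?inE.
Qed.

(** A Rasiowa-Sikorski construction: step [n] appends the real [e n], so that every real of [H] is
    enumerated, and then enters [h n] if this is a dense set. The filter consists of the initial
    segments of the limit. *)
Lemma generic_enumeration H : op_hull H -> countable H ->
  exists (g : nat -> set nat) G, [/\ forall k, H (vset (g k)),
    forall x, H (vset x) -> exists k, g k = x,
    generic (collapse H @` H) (hull_forcing H encode (@extends _) [::]) G &
    forall p, p ∈ G <-> exists n, p = encode (mkseq g n)].
Proof.
move=> HH cH; set M := collapse H @` H; have GH := op_good HH; have GP := op_poset HH.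
set Q := hull_forcing _ _ _ _.
have HT : H (vset setT) := op_hull0 (5, 0) HH.
have cM : countable M by apply: card_le_trans (card_image_le _ _) cH.
have [h [Mh hM]] : exists h : nat -> V, (forall n, M (h n)) /\ forall x, M x -> exists n, h n = x.
  by apply: countable_enum => //; exists (collapse H (vset setT)), (vset setT).
have [e [He eH]] := enumerate_reals cH HT.
have /choice[next nextP] (p : nat * seq (nat -> Prop)) : exists b, H (encode p.2) ->
    [/\ H (encode b), extends b (rcons p.2 (e p.1)) & dense Q (h p.1) -> encode b ∈ h p.1].
  case: p => n a /=; have [Ha|] := pselect (H (encode a)); last by exists [::].
  have Hae : H (encode (rcons a (e n))).
    apply/op_encode => // i; rewrite nth_rcons; case: ltnP => [_|_]; first exact: (op_encode _ HH).1.
    by case: eqP.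
  have [dD|nD] := pselect (dense Q (h n)); last first.
    by exists (rcons a (e n)) => _; split=> //; exact: extends_refl.
  have [dc dd] := dD; have [|p [pD]] := dd (encode (rcons a (e n))).
    by apply/(vin_cond _ GP); exists (rcons a (e n)).
  have /(vin_cond _ GP)[b [Hb pb]] := dc _ pD; rewrite pb => /(fle_enc GH GP Hb Hae) ba.
  by exists b => _; split=> // _; rewrite -pb.
pose a := fix a n : seq (nat -> Prop) := if n is m.+1 then next (m, a m) else [::].
have Ha n : H (encode (a n)).
  elim: n => [|n IH]; first exact: (op_hull0 (0, 0) HH).
  by have [] := nextP (n, a n) IH.
have aS n : [/\ extends (a n.+1) (rcons (a n) (e n)) & dense Q (h n) -> encode (a n.+1) ∈ h n].
  by have [] := nextP (n, a n) (Ha n).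
have aS1 n : extends (a n.+1) (a n).
  apply: extends_trans (aS n).1 _; rewrite -cats1; exact: extends_cat.
have amono m n : m <= n -> extends (a n) (a m).
  move=> /subnK <-; elim: (n - m) => [|k IH]; first exact: extends_refl.
  exact: extends_trans (aS1 _) IH.
have sa n : n <= size (a n).
  elim: n => [//|n IH]; apply: leq_trans (extends_size (aS n).1).
  by rewrite size_rcons ltnS.
(* By [sa] the sequence [a i.+1] has length at least [i.+1], so the default value is never
   reached. *)
pose g i := nth setT (a i.+1) i.
have ag n : a n = mkseq g (size (a n)).
  apply: (@eq_from_nth _ setT) => [|i ia]; first by rewrite size_mkseq.
  rewrite nth_mkseq// /g; have [ni|ni] := leqP n i.+1.
    by rewrite (extends_nth _ (amono _ _ ni)).
  by rewrite (extends_nth _ (amono _ _ (ltnW ni))).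
have Hg k : H (vset (g k)) by exact: (op_encode _ HH).1 (Ha k.+1) k.
have Hmk n : H (encode (mkseq g n)).
  apply/op_encode => // i; have [ni|ni] := ltnP i n; first by rewrite nth_mkseq.
  by rewrite nth_default ?size_mkseq.
pose G := vsup (fun n => encode (mkseq g n)).
have GE p : p ∈ G <-> exists n, p = encode (mkseq g n).
  by rewrite vin_sup; split=> -[n ?]; exists n.
exists g, G; split=> //.
  move=> x /eH[n <-]; exists (size (a n)).
  have ni : size (a n) < size (a n.+1) by have := extends_size (aS n).1; rewrite size_rcons.
  have -> : g (size (a n)) = nth setT (a n.+1) (size (a n)) by rewrite {1}(ag n.+1) nth_mkseq.
  by rewrite (extends_nth _ (aS n).1) ?size_rcons// nth_rcons ltnn eqxx.
split; last first.
  move=> D /hM[n <-] /(aS n).2 aD; exists (encode (a n.+1)); split=> //.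
  by apply/GE; exists (size (a n.+1)); rewrite {1}ag.
split.
- by move=> p /GE[n ->]; apply/(vin_cond _ GP); exists (mkseq g n).
- by apply/GE; exists 0.
- move=> p q /GE[n ->]; rewrite /fle => /(vin_le _ GH GP)[a' [b [_ _ ab /vpair_inj[/encode_inj ea ->]]]].
  apply/GE; exists (size b); rewrite -ea in ab; rewrite -{1}ab take_mkseq_le//.
  by have := extends_size ab; rewrite size_mkseq.
- move=> p q /GE[m ->] /GE[n ->]; exists (encode (mkseq g (maxn m n))); split.
  + by apply/GE; exists (maxn m n).
  + by apply/(fle_enc GH GP) => //; apply: extends_mkseq; rewrite leq_maxl.
  + by apply/(fle_enc GH GP) => //; apply: extends_mkseq; rewrite leq_maxr.
Qed.

(* The Cohen real [d] is not in the model, hence [generated g] splits [tset d]. *)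
Lemma cohen_splits H g G : op_hull H -> (forall k, H (vset (g k))) ->
  generic (collapse H @` H) (hull_forcing H encode_bits (@extends _) [::]) G ->
  ~ refining_over (extension (collapse H @` H) (hull_forcing H encode_bits (@extends _) [::]) G)
      (generated g).
Proof.
move=> HH Hg gG; have GH := op_good HH; have GP := op_poset_bits HH.
have [[Gc Gt _ Gdir] _] := gG; have [_ Hn _ _ _] := GH.
have Hb s : H (encode_bits s) by exact: Hn.
have Gsize n : exists2 s, encode_bits s ∈ G & n <= size s.
  have [|b|s [_ ns sG]] := generic_meets (P := fun s => n <= size s) GH GP _ gG.
  - exact: (op_hull0 (14, n) HH).
  - exists (b ++ nseq n false); split=> //; last exact: extends_cat.
    by rewrite size_cat size_nseq leq_addl.
  by exists s.
pose d : set nat := [set i | exists s, [/\ encode_bits s ∈ G, i < size s & nth false s i]].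
have dG s i : encode_bits s ∈ G -> i < size s -> (d i <-> nth false s i).
  move=> sG si; split=> [[t [tG ti tb]]|sb]; last by exists s.
  have [p [pG ps pt]] := Gdir _ _ sG tG.
  have /(vin_cond _ GP)[u [_ pu]] := Gc _ pG; rewrite pu in ps pt.
  have us := (fle_enc GH GP (Hb u) (Hb s)).1 ps.
  have ut := (fle_enc GH GP (Hb u) (Hb t)).1 pt.
  by rewrite -(extends_nth _ us)// (extends_nth _ ut).
have dM : ~ H (vset d).
  move=> Hd; pose P s := exists2 i, i < size s & ~ (nth false s i <-> nset (vset d) i).
  have [|b|s [_ [i si ne] sG]] := generic_meets (P := P) GH GP _ gG.
  - exact: (op_hull1 (15, 0) HH Hd).
  (* The bit appended at position [size b] is the opposite of the one in [d]. *)
  - exists (rcons b (~~ `[<d (size b)>])); split=> //.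
      exists (size b); rewrite ?size_rcons// nth_rcons ltnn eqxx nset_vset.
      by move=> [H1 H2]; have [dn|dn] := asboolP (d (size b)); rewrite /= in H1 H2;
        [have := H2 dn; rewrite asboolT|apply/dn/H1; rewrite asboolF].
    by rewrite -cats1; exact: extends_cat.
  by apply: ne; rewrite nset_vset; apply: iff_sym; exact: dG.
(* Membership of [k] depends on [d] below [k], so a condition of length at least [k] in the filter
   decides it; hence [tset d] is the value of a name. *)
have tE : tset d = [set k | exists s, [/\ H (encode_bits s), encode_bits s ∈ G & tr_forced s k]].
  apply/predeqP => k; split=> [kd|[s [_ sG]]]; last by apply=> i; exact: dG.
  have [s sG ks] := Gsize k; exists s; split=> // d' d's.
  suff /tr_agree [H1 _] : agree k d d' by exact: H1.
  by move=> u uk; have us := leq_trans uk ks; rewrite (dG s)// d's.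
move=> rG; apply: (@generated_splits g d).
  move=> k Xd; apply: dM; apply: (op_tstar HH) Xd; last exact: positive_run.
  apply: (@run_closed [set x | H (vset x)]) => [|x y|x /mapP[i _ ->]].
  - exact: (op_hull0 (5, 0) HH).
  - exact: op_setD.
  - exact: Hg.
apply: rG; first exact: tset_infinite.
by rewrite tE; apply: extension_real => //; exact: (op_hull0 (13, 0) HH).
Qed.

Lemma universality_fails T : T `<=` ZFDC -> ~ refining_universality T.
Proof.
move=> TZ; have [H [cH elH Hop]] := countable_elementary op.
have HH : op_hull H by []; have GH := op_good HH; have GP := op_poset HH.
set M := collapse H @` H.
have MT : model T M by apply: collapse_model => //; exists (vset setT); exact: (op_hull0 (5, 0) HH).
have [g [G [Hg gH gG GE]]] := generic_enumeration HH cH.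
have cM : countable M by apply: card_le_trans (card_image_le _ _) cH.
have gM : refining_over M (generated g).
  by apply: generated_refining => x /(op_real _ HH) /gH.
have gext : in_some_forcing_extension M (vset (generated g)).
  exists (hull_forcing H encode (@extends _) [::]), G; split=> //.
  - exact: hull_is_forcing.
  - exact: hull_forcing_in.
  (* The same for the generated set: block [j] is already forced by the initial segment of length
     [j.+1]. *)
  have -> : generated g =
      [set k | exists a, [/\ H (encode a), encode a ∈ G & block_forced a k]].
    apply/predeqP => k; split=> [[j jk]|[a [_ /GE[n /encode_inj ->]]]].
      exists (mkseq g j.+1); split; last first.
      + by exists j; rewrite ?size_mkseq// !take_mkseq_le// leqnSn.
      + by apply/GE; exists j.+1.
      apply/op_encode => // i; have [ni|ni] := ltnP i j.+1; first by rewrite nth_mkseq.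
      by rewrite nth_default ?size_mkseq//; exact: (op_hull0 (5, 0) HH).
    move=> [j]; rewrite size_mkseq => jn; rewrite !take_mkseq_le//; last exact: ltnW.
    by move=> jk; exists j.
  have [[Gc Gt _ _] _] := gG; apply: extension_real => //.
  exact: (op_hull0 (10, 0) HH).
have GP' := op_poset_bits HH.
move=> U; have [G' [gG']] := U M MT cM _ (@generated_infinite g) gM gext _
  (hull_is_forcing GH GP') (hull_forcing_in GH GP').
exact: cohen_splits.
Qed.

Theorem theorem7p7 :
  exists T0 : set fml, finite_fragment T0 /\
  forall T : set fml, finite_fragment T -> T0 `<=` T ->
    ~ refining_universality T /\
    (forall M : set V, model T M -> countable M ->
       exists r : set nat, infinite_set r /\ refining_over M r /\
         (forall c : nat -> nat, ~ M (vfun c) ->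
            forall N : set V, model T N -> M `<=` N -> N (vfun c) ->
              ~ refining_over N r)).
Proof.
exists T0; split; first exact: T0_fragment.
move=> T [_ TZ _] T0T; split; first exact: universality_fails.
move=> M /(model_sub T0T) MT cM; have [r [ir [rM rN]]] := refining_real_exists MT cM.
exists r; split=> //; split=> // c Mc N /(model_sub T0T) NT; exact: rN.
Qed.
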